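(* Let $\mathcal{A}$ be an abelian category, and let $\mathcal{X}$ be an additive, contravariantly finite subcategory of $\mathcal{A}$ that generates $\mathcal{A}$. Then $$\mathcal{X}\text{-}\mathrm{tri.dim}\,\mathsf{D}^{\mathrm{b}}(\mathcal{A})\leq \mathrm{gl.dim}(\mathrm{mod}\,\mathcal{X}).$$
   Context: All subcategories are full and closed under isomorphisms. $\mathsf{D}^{\mathrm{b}}(\mathcal{A})$ is the bounded derived category; $\mathcal{A}$ and its subcategories are regarded as subcategories of it via complexes concentrated in degree $0$. Relative dimension: for subcategories $\mathcal{X},\mathcal{Y}$ of a triangulated category $\mathcal{T}$, $\mathcal{X}*\mathcal{Y}$ is the subcategory of objects $M$ admitting an exact triangle $X\to M\to Y\to X[1]$ with $X\in\mathcal{X}$, $Y\in\mathcal{Y}$ (this operation is associative). $\mathrm{add}\,\mathcal{X}$ is the smallest subcategory containing $\mathcal{X}$ closed under finite direct sums and direct summands. Put $\langle\mathcal{X}\rangle=\mathrm{add}\{X[i]\mid X\in\mathcal{X},\,i\in\mathbb{Z}\}$ and, for $n\ge 1$, $\langle\mathcal{X}\rangle_n=\mathrm{add}(\langle\mathcal{X}\rangle*\cdots*\langle\mathcal{X}\rangle)$ ($n$ factors). Then $\mathcal{X}\text{-}\mathrm{tri.dim}\,\mathcal{T}:=\inf\{n\ge0\mid\mathcal{T}=\langle\mathcal{X}\rangle_{n+1}\}$ (with value $\infty$ if there is no such $n$). $\mathcal{X}$ is contravariantly finite in $\mathcal{A}$ if for every $M\in\mathcal{A}$ there is a morphism $f:X\to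 M$ with $X\in\mathcal{X}$ such that $\mathrm{Hom}_{\mathcal{A}}(X',f)$ is surjective for all $X'\in\mathcal{X}$. $\mathcal{X}$ generates $\mathcal{A}$ if every $M\in\mathcal{A}$ admits an epimorphism $X\to M$ with $X\in\mathcal{X}$. $\mathrm{mod}\,\mathcal{X}$ is the category of finitely presented $\mathcal{X}$-modules, i.e. additive contravariant functors $F$ from $\mathcal{X}$ to abelian groups admitting an exact sequence $\mathrm{Hom}_{\mathcal{X}}(-,X_1)\to\mathrm{Hom}_{\mathcal{X}}(-,X_0)\to F\to0$ with $X_0,X_1\in\mathcal{X}$; morphisms are natural transformations. When $\mathcal{A}$ is an abelian category and $\mathcal{X}$ is an additive, contravariantly finite subcategory of $\mathcal{A}$ that generates $\mathcal{A}$, $\mathrm{mod}\,\mathcal{X}$ is an abelian category with enough projectives. For an abelian category with enough projectives, $\mathrm{gl.dim}$ is the supremum of the projective dimensions of its objects. *)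

(* Defs.v *)
From HB Require Import structures.
From mathcomp Require Import all_boot all_order all_algebra.
From mathcomp Require Import generic_quotient boolp zify.

Set Implicit Arguments.
Unset Strict Implicit.
Unset Printing Implicit Defensive.

Import GRing.Theory.
Local Open Scope ring_scope.

(** * Extended natural numbers: [None] stands for infinity *)

Definition enat := option nat.

Definition enat_le (x y : enat) : Prop :=
  match x, y with
  | _, None => True
  | None, Some _ => False
  | Some m, Some n => (m <= n)%N
  end.

Definition enat_inf (P : nat -> Prop) : enat :=
  match pselect (exists n, `[< P n >]) with
  | left exP => Some (ex_minn exP)
  | right _ => None
  end.

(* The least upper bound of [f] is its least finite upper bound, or infinity
   if there is none. *)
Definition enat_sup (I : Type) (f : I -> enat) : enat :=
  enat_inf (fun n => forall i, enat_le (f i) (Some n)).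

(** * Categories *)

Record category := Category {
  obj :> Type;
  hom : obj -> obj -> Type;
  idm : forall X, hom X X;
  comp : forall X Y Z, hom Y Z -> hom X Y -> hom X Z;
  compA : forall W X Y Z (h : hom Y Z) (g : hom X Y) (f : hom W X),
    comp h (comp g f) = comp (comp h g) f;
  comp1m : forall X Y (f : hom X Y), comp (idm Y) f = f;
  compm1 : forall X Y (f : hom X Y), comp f (idm X) = f
}.

Arguments idm {c} X.

Reserved Notation "X ~> Y" (at level 70, no associativity).
Reserved Notation "g ∘ f" (at level 40, left associativity).
Reserved Notation "g • f" (at level 40, left associativity).

Notation "X ~> Y" := (hom X Y) : type_scope.
Notation "g ∘ f" := (comp g f) : ring_scope.

Section CategoryNotions.
Variable T : category.
Implicit Types X Y Z M N P : T.

Definition is_iso X Y (f : X ~> Y) :=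
  exists g : Y ~> X, g ∘ f = idm X /\ f ∘ g = idm Y.

Definition isomorphic X Y := exists f : X ~> Y, is_iso f.

Definition iso_closed (S : T -> Prop) :=
  forall X Y, isomorphic X Y -> S X -> S Y.

Definition mono X Y (f : X ~> Y) :=
  forall W (g h : W ~> X), f ∘ g = f ∘ h -> g = h.

Definition epi X Y (f : X ~> Y) :=
  forall Z (g h : Y ~> Z), g ∘ f = h ∘ f -> g = h.

Definition zero_object Z :=
  (forall X, exists! f : X ~> Z, True) /\ (forall X, exists! f : Z ~> X, True).

Definition zero_morphism X Y (f : X ~> Y) :=
  exists Z (g : Z ~> Y) (h : X ~> Z), zero_object Z /\ f = g ∘ h.

Definition is_kernel K X Y (k : K ~> X) (f : X ~> Y) :=
  zero_morphism (f ∘ k) /\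
  forall W (g : W ~> X), zero_morphism (f ∘ g) -> exists! u : W ~> K, k ∘ u = g.

Definition is_cokernel X Y Q (q : Y ~> Q) (f : X ~> Y) :=
  zero_morphism (q ∘ f) /\
  forall Z (g : Y ~> Z), zero_morphism (g ∘ f) -> exists! u : Q ~> Z, u ∘ q = g.

Definition is_coproduct X Y S (i1 : X ~> S) (i2 : Y ~> S) :=
  forall Z (f : X ~> Z) (g : Y ~> Z),
    exists! u : S ~> Z, u ∘ i1 = f /\ u ∘ i2 = g.

(* In an additive category the direct sum is the coproduct. *)
Definition is_direct_sum X Y S :=
  exists (i1 : X ~> S) (i2 : Y ~> S), is_coproduct i1 i2.

(* Exactness at [Y] in an abelian category: the morphism from [X] to the
   kernel of [g] induced by [f] is an epimorphism. *)
Definition exact_at X Y Z (f : X ~> Y) (g : Y ~> Z) :=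
  exists K (k : K ~> Y) (u : X ~> K), [/\ is_kernel k g, f = k ∘ u & epi u].

Definition projective P :=
  forall M N (e : M ~> N) (f : P ~> N), epi e -> exists g : P ~> M, e ∘ g = f.

(* An exact sequence 0 -> P_n -> ... -> P_0 -> M -> 0 with all P_i projective. *)
Definition projective_resolution M n :=
  exists (P : nat -> T) (d : forall i, P i.+1 ~> P i) (e : P 0%N ~> M),
    [/\ forall i, projective (P i),
        forall i, (n < i)%N -> zero_object (P i),
        epi e,
        exact_at (d 0%N) e
      & forall i, exact_at (d i.+1) (d i)].

Definition proj_dim M : enat := enat_inf (projective_resolution M).

Definition gl_dim : enat := enat_sup proj_dim.

(* [add S] is the smallest subcategory containing [S] that is closed under
   isomorphisms, finite direct sums (the empty one included) and direct
   summands. *)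
Inductive add (S : T -> Prop) : T -> Prop :=
  | add_incl X : S X -> add S X
  | add_iso X Y : isomorphic X Y -> add S X -> add S Y
  | add_zero Z : zero_object Z -> add S Z
  | add_sum X Y M : is_direct_sum X Y M -> add S X -> add S Y -> add S M
  | add_summand X Y M : is_direct_sum X Y M -> add S M -> add S X.

End CategoryNotions.

(** * Preadditive and abelian categories, subcategories *)

(* Not an extension of [category]: module categories and derived categories
   have morphisms in a universe larger than that of the abelian groups used
   here, so that only the forgetful coercion [cat_of] below is available. *)
Record preadditive := Preadditive {
  pobj :> Type;
  phom : pobj -> pobj -> zmodType;
  pidm : forall X, phom X X;
  pcomp : forall X Y Z, phom Y Z -> phom X Y -> phom X Z;
  pcompA : forall W X Y Z (h : phom Y Z) (g : phom X Y) (f : phom W X),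
    pcomp h (pcomp g f) = pcomp (pcomp h g) f;
  pcomp1m : forall X Y (f : phom X Y), pcomp (pidm Y) f = f;
  pcompm1 : forall X Y (f : phom X Y), pcomp f (pidm X) = f;
  pcompDl : forall X Y Z (g g' : phom Y Z) (f : phom X Y),
    pcomp (g + g') f = pcomp g f + pcomp g' f;
  pcompDr : forall X Y Z (g : phom Y Z) (f f' : phom X Y),
    pcomp g (f + f') = pcomp g f + pcomp g f'
}.

Arguments pidm {p} X.

Notation "g • f" := (pcomp g f) : ring_scope.

Definition cat_of (A : preadditive) : category :=
  @Category (pobj A) (fun X Y => phom X Y) (@pidm A) (@pcomp A)
    (@pcompA A) (@pcomp1m A) (@pcompm1 A).

Coercion cat_of : preadditive >-> category.

Record abelian (A : preadditive) : Prop := Abelian {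
  ab_zero : exists Z : A, zero_object (T := A) Z;
  ab_sum : forall X Y : A, exists S : A, is_direct_sum (T := A) X Y S;
  ab_kernel : forall (X Y : A) (f : hom (c := A) X Y),
    exists K (k : hom (c := A) K X), is_kernel k f;
  ab_cokernel : forall (X Y : A) (f : hom (c := A) X Y),
    exists Q (q : hom (c := A) Y Q), is_cokernel q f;
  ab_mono : forall (X Y : A) (f : hom (c := A) X Y), mono f ->
    exists Z (g : hom (c := A) Y Z), is_kernel f g;
  ab_epi : forall (X Y : A) (f : hom (c := A) X Y), epi f ->
    exists W (g : hom (c := A) W X), is_cokernel f g
}.

Section Subcategories.
Variable A : preadditive.

(* A full subcategory closed under isomorphisms is given by its objects. *)
Record additive_subcategory (X : A -> Prop) : Prop := AdditiveSubcategory {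
  as_iso : iso_closed (T := A) X;
  as_zero : forall Z : A, zero_object (T := A) Z -> X Z;
  as_sum : forall M N S : A, is_direct_sum (T := A) M N S -> X M -> X N -> X S
}.

Definition contravariantly_finite (X : A -> Prop) :=
  forall M : A, exists (x : A) (f : hom (c := A) x M), X x /\
    forall (x' : A) (g : hom (c := A) x' M), X x' ->
      exists h : hom (c := A) x' x, f ∘ h = g.

Definition generating (X : A -> Prop) :=
  forall M : A, exists (x : A) (f : hom (c := A) x M), X x /\ epi f.

Definition full_sub (X : A -> Prop) : preadditive :=
  @Preadditive {x : A | X x} (fun x y => phom (sval x) (sval y))
    (fun x => pidm (sval x)) (fun x y z g f => g • f)
    (fun w x y z h g f => pcompA h g f)
    (fun x y f => pcomp1m f) (fun x y f => pcompm1 f)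
    (fun x y z g g' f => pcompDl g g' f) (fun x y z g f f' => pcompDr g f f').

End Subcategories.

(** * Finitely presented modules over a preadditive category *)

Section Modules.
Variable C : preadditive.

(* Additive contravariant functors to abelian groups. *)
Record cmodule := CModule {
  mob :> C -> zmodType;
  mact : forall x y : C, phom x y -> mob y -> mob x;
  mact_add : forall (x y : C) (f : phom x y), zmod_morphism (mact f);
  mact_addl : forall (x y : C) (m : mob y),
    zmod_morphism (fun f : phom x y => mact f m);
  mact_id : forall (x : C) (m : mob x), mact (pidm x) m = m;
  mact_comp : forall (x y z : C) (g : phom y z) (f : phom x y) (m : mob z),
    mact (g • f) m = mact f (mact g m)
}.

Record nat_trans (F G : cmodule) := NatTrans {
  nt :> forall x : C, F x -> G x;
  nt_add : forall x : C, zmod_morphism (nt (x := x));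
  nt_nat : forall (x y : C) (f : phom x y) (m : F y),
    nt (mact f m) = mact f (nt m)
}.

Lemma nat_trans_ext (F G : cmodule) (a b : nat_trans F G) :
  (forall x m, a x m = b x m) -> a = b.
Proof.
case: a b => [a aA aN] [b bA bN] /= eab.
have {}eab : a = b.
  by apply: functional_extensionality_dep => x; apply/funext => m; exact: eab.
by subst b; congr NatTrans; exact: Prop_irrelevance.
Qed.

Definition nt_id (F : cmodule) : nat_trans F F.
Proof. by exists (fun x m => m). Defined.

Definition nt_comp (F G H : cmodule) (b : nat_trans G H) (a : nat_trans F G) :
  nat_trans F H.
Proof.
exists (fun x m => b x (a x m)) => [x m m' | x y f m].
  by rewrite (nt_add a) (nt_add b).
by rewrite !nt_nat.
Defined.

Lemma pcompBl (X Y Z : C) (g g' : phom Y Z) (f : phom X Y) :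
  (g - g') • f = g • f - g' • f.
Proof. by apply: (addIr (g' • f)); rewrite -pcompDl !subrK. Qed.

Lemma pcompBr (X Y Z : C) (g : phom Y Z) (f f' : phom X Y) :
  g • (f - f') = g • f - g • f'.
Proof. by apply: (addIr (g • f')); rewrite -pcompDr !subrK. Qed.

Definition yoneda (z : C) : cmodule.
Proof.
exists (fun x => phom x z) (fun x y f m => m • f) => [x y f m m' | x y m f f' | x m | x y w g f m].
- exact: pcompBl.
- exact: pcompBr.
- exact: pcompm1.
- exact: pcompA.
Defined.

(* Exactness of C(-,x1) -> C(-,x0) -> F -> 0 is objectwise. *)
Definition finitely_presented (F : cmodule) :=
  exists (x1 x0 : C) (a : nat_trans (yoneda x1) (yoneda x0))
         (b : nat_trans (yoneda x0) F),
    (forall (x : C) (m : F x), exists f, b x f = m) /\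
    (forall (x : C) (f : yoneda x0 x), b x f = 0 <-> exists g, a x g = f).

Definition fp_mod : category.
Proof.
apply: (@Category {F : cmodule | finitely_presented F}
  (fun F G => nat_trans (sval F) (sval G)) (fun F => nt_id (sval F))
  (fun F G H b a => nt_comp b a)) => *; exact: nat_trans_ext.
Defined.

End Modules.

(** * Bounded complexes *)

(* [sgn k f] is (-1)^k f. *)
Definition sgn (V : zmodType) (k : int) (v : V) : V :=
  if odd `|k|%N then - v else v.

Section Complexes.
Variable A : preadditive.

(* Cohomologically graded. Differentials are given between any two degrees, and
   vanish unless the degrees are consecutive; this avoids transports along
   equalities of integers. *)
Record bcomplex := BComplex {
  cob :> int -> A;
  cd : forall i j, phom (cob i) (cob j);
  cd_shape : forall i j, j <> i + 1 -> cd i j = 0;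
  cd_comp : forall i j k, cd j k • cd i j = 0;
  cbounded : exists N : nat, forall i : int, (N < `|i|)%N ->
    zero_object (T := A) (cob i)
}.

Record chain_map (C D : bcomplex) := ChainMap {
  cm :> forall i, phom (C i) (D i);
  cm_comm : forall i j, cd D i j • cm i = cm j • cd C i j
}.

Definition cm_id (C : bcomplex) : chain_map C C.
Proof.
by exists (fun i => pidm (C i)) => i j; rewrite pcomp1m pcompm1.
Defined.

Definition cm_comp (C D E : bcomplex) (g : chain_map D E) (f : chain_map C D) :
  chain_map C E.
Proof.
exists (fun i => g i • f i) => i j.
by rewrite pcompA cm_comm -!pcompA cm_comm.
Defined.

Definition homotopic (C D : bcomplex) (f g : chain_map C D) :=
  exists s : forall i j, phom (C i) (D j),
    forall i j k : int, i + 1 = j -> j + 1 = k ->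
      f j - g j = cd D i j • s j i + s k j • cd C j k.

(* [H], with the projection [p] from the cycles [z : Z -> C^j], is the
   cohomology of [C] in degree [j]. *)
Definition is_cohomology (C : bcomplex) (j : int) (Z H : A)
    (z : hom (c := A) Z (C j)) (p : hom (c := A) Z H) :=
  forall i k : int, i + 1 = j -> j + 1 = k ->
    is_kernel (T := A) z (cd C j k) /\
    exists b : hom (c := A) (C i) Z, z ∘ b = cd C i j /\ is_cokernel p b.

(* The morphism [h] induced by [f] on cohomology is invertible in each degree. *)
Definition quasi_iso (C D : bcomplex) (f : chain_map C D) :=
  forall (j : int) (Z H Z' H' : A)
    (z : hom (c := A) Z (C j)) (p : hom (c := A) Z H)
    (z' : hom (c := A) Z' (D j)) (p' : hom (c := A) Z' H')
    (u : hom (c := A) Z Z') (h : hom (c := A) H H'),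
    is_cohomology z p -> is_cohomology z' p' ->
    z' ∘ u = (f j : hom (c := A) _ _) ∘ z -> h ∘ p = p' ∘ u -> is_iso h.

Lemma pcompNl (X Y Z : A) (g : phom Y Z) (f : phom X Y) : (- g) • f = - (g • f).
Proof. by rewrite -[- g]sub0r pcompBl -(subrr g) pcompBl subrr sub0r. Qed.

Lemma pcompNr (X Y Z : A) (g : phom Y Z) (f : phom X Y) : g • (- f) = - (g • f).
Proof. by rewrite -[- f]sub0r pcompBr -(subrr f) pcompBr subrr sub0r. Qed.

Lemma sgn_compl (X Y Z : A) k (g : phom Y Z) (f : phom X Y) :
  sgn k g • f = sgn k (g • f).
Proof. by rewrite /sgn; case: odd; rewrite ?pcompNl. Qed.

Lemma sgn_compr (X Y Z : A) k (g : phom Y Z) (f : phom X Y) :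
  g • sgn k f = sgn k (g • f).
Proof. by rewrite /sgn; case: odd; rewrite ?pcompNr. Qed.

Lemma sgn0 (V : zmodType) k : sgn k (0 : V) = 0.
Proof. by rewrite /sgn oppr0 if_same. Qed.

Lemma sgnK (V : zmodType) k (v : V) : sgn k (sgn k v) = v.
Proof. by rewrite /sgn; case: odd; rewrite ?opprK. Qed.

Lemma sgnD (V : zmodType) k (v w : V) : sgn k (v + w) = sgn k v + sgn k w.
Proof. by rewrite /sgn; case: odd; rewrite ?opprD. Qed.

(* [C[k]]^i = C^(i+k), with differential (-1)^k d. *)
Definition cshift (k : int) (C : bcomplex) : bcomplex.
Proof.
exists (fun i => C (i + k)) (fun i j => sgn k (cd C (i + k) (j + k))).
- move=> i j ij; rewrite cd_shape ?sgn0 // => e.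
  by apply: ij; apply: (addIr k); rewrite e addrAC.
- by move=> i j l; rewrite sgn_compl sgn_compr cd_comp !sgn0.
- have [N CN] := cbounded C; exists (N + `|k|)%N => i Ni; apply: CN.
  by lia.
Defined.

Definition cm_shift (k : int) (C D : bcomplex) (f : chain_map C D) :
  chain_map (cshift k C) (cshift k D).
Proof.
exists (fun i => f (i + k)) => i j /=.
by rewrite sgn_compl sgn_compr cm_comm.
Defined.

Lemma zero_morphism_sgn (X Y : A) k (f : phom X Y) :
  zero_morphism (T := A) (sgn k f) <-> zero_morphism (T := A) f.
Proof.
have imp (g : phom X Y) :
    zero_morphism (T := A) g -> zero_morphism (T := A) (sgn k g).
  move=> [Z [a [b [Z0 ->]]]]; exists Z, (sgn k (a : phom Z Y)), b.
  by split=> //=; rewrite sgn_compl.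
by split=> [/imp|/imp//]; rewrite sgnK.
Qed.

Lemma is_kernel_sgn (K X Y : A) k (z : phom K X) (f : phom X Y) :
  is_kernel (T := A) z (sgn k f) <-> is_kernel (T := A) z f.
Proof.
have e W (g : phom W X) :
    zero_morphism (T := A) (sgn k f • g) <-> zero_morphism (T := A) (f • g).
  by rewrite sgn_compl zero_morphism_sgn.
by split=> -[z0 zu]; (split=> [|W g g0]; [exact/e|apply: zu; exact/e]).
Qed.

Lemma is_cokernel_sgn (X Y Q : A) k (q : phom Y Q) (f : phom X Y) :
  is_cokernel (T := A) q (sgn k f) <-> is_cokernel (T := A) q f.
Proof.
have e W (g : phom Y W) :
    zero_morphism (T := A) (g • sgn k f) <-> zero_morphism (T := A) (g • f).
  by rewrite sgn_compr zero_morphism_sgn.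
by split=> -[z0 zu]; (split=> [|W g g0]; [exact/e|apply: zu; exact/e]).
Qed.

Lemma is_cohomology_shift (k : int) (C : bcomplex) (j : int) (Z H : A)
    (z : hom (c := A) Z (C (j + k))) (p : hom (c := A) Z H) :
  is_cohomology (C := cshift k C) (j := j) z p -> is_cohomology z p.
Proof.
move=> cz i l ij jl.
have {ij} ei : i = (j - 1) + k by lia.
have {jl} el : l = (j + 1) + k by lia.
subst i l; have [] := cz (j - 1) (j + 1) (subrK _ _) erefl.
rewrite is_kernel_sgn => kz [b [zb pb]]; split=> //.
exists (sgn k (b : phom _ _)); split; last by rewrite is_cokernel_sgn.
by rewrite /= sgn_compr [_ • _]zb /= sgnK.
Qed.

Lemma quasi_iso_shift (k : int) (C D : bcomplex) (f : chain_map C D) :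
  quasi_iso f -> quasi_iso (cm_shift k f).
Proof.
move=> qf j Z H Z' H' z p z' p' u h /is_cohomology_shift cz.
by move=> /is_cohomology_shift cz'; apply: qf cz cz'.
Qed.

Lemma homotopic_shift (k : int) (C D : bcomplex) (f g : chain_map C D) :
  homotopic f g -> homotopic (cm_shift k f) (cm_shift k g).
Proof.
move=> [s fg]; exists (fun i j => sgn k (s (i + k) (j + k))) => i j l ij jl /=.
rewrite (fg (i + k) (j + k) (l + k)); [|lia|lia].
by rewrite !sgn_compl !sgn_compr !sgnK.
Qed.

(* [K], with [i : D -> K] and [p : K -> C[1]], is the mapping cone of [f]:
   K^n = C^(n+1) (+) D^n, and the component C^(n+1) -> D^(n+1) of the
   differential is f^(n+1).  Since [i] and [p] are chain maps, the other
   components are -d_C, d_D and 0. *)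
Definition is_cone (C D K : bcomplex) (f : chain_map C D)
    (i : chain_map D K) (p : chain_map K (cshift 1 C)) :=
  exists (s : forall n, phom (C (n + 1)) (K n)) (t : forall n, phom (K n) (D n)),
    [/\ forall n, p n • s n = pidm (C (n + 1)),
        forall n, t n • i n = pidm (D n),
        forall n, p n • i n = 0 /\ t n • s n = 0,
        forall n, s n • p n + i n • t n = pidm (K n)
      & forall n, t (n + 1) • cd K n (n + 1) • s n = f (n + 1)].

End Complexes.

(** * The bounded derived category *)

Section DerivedCategory.
Variable A : preadditive.
Implicit Types C D E : bcomplex A.

(* The localization of the homotopy category of bounded complexes at the
   quasi-isomorphisms, presented by generators and relations: its morphisms are
   the formal composites of chain maps and of formal inverses of
   quasi-isomorphisms, modulo [dterm_eq]. *)
Inductive dterm : bcomplex A -> bcomplex A -> Type :=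
  | dt_map C D : chain_map C D -> dterm C D
  | dt_inv C D (s : chain_map C D) : quasi_iso s -> dterm D C
  | dt_comp C D E : dterm D E -> dterm C D -> dterm C E.

Inductive dterm_eq : forall C D, dterm C D -> dterm C D -> Prop :=
  | dte_refl C D (a : dterm C D) : dterm_eq a a
  | dte_sym C D (a b : dterm C D) : dterm_eq a b -> dterm_eq b a
  | dte_trans C D (a b c : dterm C D) :
      dterm_eq a b -> dterm_eq b c -> dterm_eq a c
  | dte_comp C D E (a a' : dterm D E) (b b' : dterm C D) :
      dterm_eq a a' -> dterm_eq b b' -> dterm_eq (dt_comp a b) (dt_comp a' b')
  | dte_compA B C D E (a : dterm D E) (b : dterm C D) (c : dterm B C) :
      dterm_eq (dt_comp a (dt_comp b c)) (dt_comp (dt_comp a b) c)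
  | dte_comp1m C D (a : dterm C D) :
      dterm_eq (dt_comp (dt_map (cm_id D)) a) a
  | dte_compm1 C D (a : dterm C D) :
      dterm_eq (dt_comp a (dt_map (cm_id C))) a
  | dte_map_comp C D E (g : chain_map D E) (f : chain_map C D) :
      dterm_eq (dt_map (cm_comp g f)) (dt_comp (dt_map g) (dt_map f))
  | dte_homotopic C D (f g : chain_map C D) :
      homotopic f g -> dterm_eq (dt_map f) (dt_map g)
  | dte_mapK C D (s : chain_map C D) (qs : quasi_iso s) :
      dterm_eq (dt_comp (dt_inv qs) (dt_map s)) (dt_map (cm_id C))
  | dte_invK C D (s : chain_map C D) (qs : quasi_iso s) :
      dterm_eq (dt_comp (dt_map s) (dt_inv qs)) (dt_map (cm_id D)).

HB.instance Definition _ C D := gen_eqMixin (dterm C D).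
HB.instance Definition _ C D := gen_choiceMixin (dterm C D).

Definition dterm_eqb C D : rel (dterm C D) := fun a b => `[< dterm_eq a b >].

Lemma dterm_eqb_refl C D : reflexive (@dterm_eqb C D).
Proof. by move=> a; apply/asboolP/dte_refl. Qed.

Lemma dterm_eqb_sym C D : symmetric (@dterm_eqb C D).
Proof. by move=> a b; apply/asboolP/asboolP => /dte_sym. Qed.

Lemma dterm_eqb_trans C D : transitive (@dterm_eqb C D).
Proof.
by move=> b a c /asboolP ab /asboolP bc; apply/asboolP; apply: dte_trans bc.
Qed.

Canonical dterm_equiv C D :=
  EquivRel (@dterm_eqb C D) (@dterm_eqb_refl C D) (@dterm_eqb_sym C D)
    (@dterm_eqb_trans C D).

Definition dhom C D : Type := {eq_quot (@dterm_equiv C D)}%qT.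

Definition dclass C D (a : dterm C D) : dhom C D :=
  \pi_({eq_quot (@dterm_equiv C D)})%qT a.

Definition drepr C D (u : dhom C D) : dterm C D :=
  repr (u : {eq_quot (@dterm_equiv C D)}%qT).

Lemma dreprK C D (u : dhom C D) : dclass (drepr u) = u.
Proof. by rewrite /dclass /drepr reprK. Qed.

Lemma dclassP C D (a b : dterm C D) : dclass a = dclass b <-> dterm_eq a b.
Proof.
split=> [/eqmodP/asboolP //|ab].
by apply/eqmodP/asboolP.
Qed.

Lemma drepr_class C D (a : dterm C D) : dterm_eq (drepr (dclass a)) a.
Proof. by apply/dclassP; rewrite dreprK. Qed.

Definition dmap C D (f : chain_map C D) : dhom C D := dclass (dt_map f).

Definition dcomp C D E (v : dhom D E) (u : dhom C D) : dhom C E :=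
  dclass (dt_comp (drepr v) (drepr u)).

Lemma dcomp_class C D E (a : dterm D E) (b : dterm C D) :
  dcomp (dclass a) (dclass b) = dclass (dt_comp a b).
Proof. by apply/dclassP/dte_comp; apply: drepr_class. Qed.

Definition derived_cat : category.
Proof.
apply: (@Category (bcomplex A) dhom (fun C => dmap (cm_id C)) dcomp).
- move=> B C D E h g f; rewrite -(dreprK h) -(dreprK g) -(dreprK f).
  by rewrite !dcomp_class; apply/dclassP/dte_compA.
- by move=> C D f; rewrite -(dreprK f) dcomp_class; apply/dclassP/dte_comp1m.
- by move=> C D f; rewrite -(dreprK f) dcomp_class; apply/dclassP/dte_compm1.
Defined.

Fixpoint dterm_shift (k : int) C D (a : dterm C D) :
    dterm (cshift k C) (cshift k D) :=
  match a in dterm C D return dterm (cshift k C) (cshift k D) with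
  | dt_map C D f => dt_map (cm_shift k f)
  | dt_inv C D s qs => dt_inv (@quasi_iso_shift A k C D s qs)
  | dt_comp C D E b c => dt_comp (dterm_shift k b) (dterm_shift k c)
  end.

Definition dshift (k : int) C D (u : dhom C D) :
  dhom (cshift k C) (cshift k D) := dclass (dterm_shift k (drepr u)).

Lemma chain_map_ext C D (f g : chain_map C D) : (forall i, f i = g i) -> f = g.
Proof.
case: f g => [f fP] [g gP] /= efg.
have {}efg : f = g by apply: functional_extensionality_dep.
by subst g; congr ChainMap; exact: Prop_irrelevance.
Qed.

Lemma dterm_shift_eq (k : int) C D (a b : dterm C D) :
  dterm_eq a b -> dterm_eq (dterm_shift k a) (dterm_shift k b).
Proof.
have sid E : cm_shift k (cm_id E) = cm_id (cshift k E) by apply: chain_map_ext.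
have smap E F G (g : chain_map F G) (f : chain_map E F) :
  cm_shift k (cm_comp g f) = cm_comp (cm_shift k g) (cm_shift k f).
  exact: chain_map_ext.
elim=> /= *; rewrite ?sid ?smap; try by econstructor; eauto.
by apply/dte_homotopic/homotopic_shift.
Qed.

Lemma dshift_class (k : int) C D (a : dterm C D) :
  dshift k (dclass a) = dclass (dterm_shift k a).
Proof. by apply/dclassP/dterm_shift_eq/drepr_class. Qed.

(* The triangles isomorphic to the triangle of a mapping cone. *)
Definition exact_triangle (X Y Z : derived_cat)
    (f : X ~> Y) (g : Y ~> Z) (h : Z ~> (cshift 1 X : derived_cat)) :=
  exists (C D K : bcomplex A) (u : chain_map C D) (i : chain_map D K)
         (p : chain_map K (cshift 1 C)),
    is_cone u i p /\
    exists (a : X ~> (C : derived_cat)) (b : Y ~> (D : derived_cat))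
           (c : Z ~> (K : derived_cat)),
      [/\ is_iso a, is_iso b & is_iso c] /\
      [/\ b ∘ f = (dmap u : hom (c := derived_cat) C D) ∘ a,
          c ∘ g = (dmap i : hom (c := derived_cat) D K) ∘ b
        & (dshift 1 a : hom (c := derived_cat) (cshift 1 X) (cshift 1 C)) ∘ h =
          (dmap p : hom (c := derived_cat) K (cshift 1 C)) ∘ c].

End DerivedCategory.

(** * Relative dimension of triangulated categories *)

(* The part of the structure of a triangulated category on which the dimension
   depends. *)
Record tri_data := TriData {
  tri_cat :> category;
  shift : int -> tri_cat -> tri_cat;
  distinguished : forall X Y Z : tri_cat,
    X ~> Y -> Y ~> Z -> Z ~> shift 1 X -> Prop
}.

Section RelativeDimension.
Variable T : tri_data.
Implicit Types S : T -> Prop.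

Definition star S1 S2 (M : T) :=
  exists (X Y : T) (f : X ~> M) (g : M ~> Y) (h : Y ~> shift 1 X),
    [/\ S1 X, S2 Y & distinguished f g h].

Definition angle S : T -> Prop :=
  add (fun M => exists X (k : int), S X /\ M = shift k X).

(* <S>_n for n >= 1, with n factors in the iterated [star]. *)
Definition angle_pow S (n : nat) : T -> Prop :=
  add (iter n.-1 (star (angle S)) (angle S)).

Definition tri_dim S : enat :=
  enat_inf (fun n => forall M : T, angle_pow S n.+1 M).

End RelativeDimension.

Definition Db (A : preadditive) : tri_data :=
  @TriData (derived_cat A) (@cshift A) (@exact_triangle A).

(* [X], viewed in the derived category by means of complexes concentrated in
   degree 0. *)
Definition in_degree0 (A : preadditive) (X : A -> Prop) (C : Db A) : Prop :=
  let C' : bcomplex A := C in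
  X (C' 0) /\ forall i : int, i <> 0 -> zero_object (T := A) (C' i).

(* Main.v *)
From HB Require Import structures.
From mathcomp Require Import all_boot all_order all_algebra.
From mathcomp Require Import generic_quotient ring_quotient boolp zify.
Require Import Defs.

(* Write h for the functor sending M to Hom(-,M) restricted to X. If gl.dim
   (mod X) = n, every module H^j(hM) has a projective resolution of length n, and
   its terms are of the form hQ with Q a retract of an object of X. Let Q^j be the
   degree 0 term for H^j(hM). The covers hQ^j -> H^j(hM) lift to chain maps
   Q^j[-j] -> M, and in the triangle sum_j Q^j[-j] -> M -> K the module H^j(hK) is
   the kernel of hQ^(j+1) -> H^(j+1)(hM), so that its resolution is one step
   shorter. When the length is 0 the lifts induce isomorphisms on the cohomology of
   hM, and therefore quasi-isomorphisms, since X generates. Thus n cones show that M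
   lies in <X>_(n+1). *)

Set Implicit Arguments.
Unset Strict Implicit.
Unset Printing Implicit Defensive.

Import GRing.Theory.
Local Open Scope ring_scope.

(** * Abelian categories without chosen limits *)

(** A projective of mod X is a summand of some hx with x in X; the idempotent of x that cuts it out
    splits in A, but perhaps not in X. This is why retracts appear, and closure of [add] under
    summands absorbs them. That H^j(hM) lies in mod X at all comes from contravariant finiteness:
    the object of cycles, and then the object of relations, have right approximations by X. The
    covers hQ^j -> H^j(hM) lift to cycles because hQ^j is projective, and the lifts come from
    morphisms of A by Yoneda. Since the covers are surjective in every degree, the long exact
    sequence of the cone breaks into short ones. Neither kernels in mod X nor roofs in the derived
    category are constructed: resolutions are restated as conditions on morphisms of A, and the
    derived category, given by generators and relations, is handled through its universal property.
    The iterated [star] nests to the right, in the order in which the cones are taken. *)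

Section Preadditive.
Variable A : preadditive.
Implicit Types W X Y Z : A.

Lemma pcomp0m X Y Z (f : phom X Y) : (0 : phom Y Z) • f = 0.
Proof. by rewrite -(subrr (0 : phom Y Z)) pcompBl subrr. Qed.

Lemma pcompm0 X Y Z (g : phom Y Z) : g • (0 : phom X Y) = 0.
Proof. by rewrite -(subrr (0 : phom X Y)) pcompBr subrr. Qed.

Lemma zero_objectE Z : zero_object (T := A) Z <-> pidm Z = 0.
Proof.
split=> [[/(_ Z)[f [_ f1]] _]|Z0].
  by rewrite -(f1 (pidm Z) I) -(f1 0 I).
split=> X; exists (0 : phom _ _); split=> // f _.
  by rewrite -[f in RHS]pcomp1m Z0 pcomp0m.
by rewrite -[f in RHS]pcompm1 Z0 pcompm0.
Qed.

Lemma to_zero X Z (f : phom X Z) : zero_object (T := A) Z -> f = 0.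
Proof. by move=> /zero_objectE Z0; rewrite -[f]pcomp1m Z0 pcomp0m. Qed.

Lemma zero_morphism0 X Y (f : phom X Y) : zero_morphism (T := A) f -> f = 0.
Proof. by move=> [Z [g [h [Z0 ->]]]]; rewrite [h]to_zero // /= pcompm0. Qed.

Definition pmono X Y (f : phom X Y) := forall W (g : phom W X), f • g = 0 -> g = 0.

Definition pepi X Y (f : phom X Y) := forall Z (g : phom Y Z), g • f = 0 -> g = 0.

Lemma monoE X Y (f : phom X Y) : mono (T := A) f <-> pmono f.
Proof.
split=> [mf W g fg|mf W /= g h fgh]; first by apply: mf; rewrite /= fg pcompm0.
by apply/eqP; rewrite -subr_eq0; apply/eqP/mf; rewrite pcompBr fgh subrr.
Qed.

Lemma epiE X Y (f : phom X Y) : epi (T := A) f <-> pepi f.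
Proof.
split=> [ef W g fg|ef W /= g h fgh]; first by apply: ef; rewrite /= fg pcomp0m.
by apply/eqP; rewrite -subr_eq0; apply/eqP/ef; rewrite pcompBl fgh subrr.
Qed.

Definition kernel_of K X Y (k : phom K X) (f : phom X Y) :=
  [/\ f • k = 0, pmono k
    & forall W (g : phom W X), f • g = 0 -> exists u : phom W K, k • u = g].

Definition cokernel_of X Y Q (q : phom Y Q) (f : phom X Y) :=
  [/\ q • f = 0, pepi q
    & forall Z (g : phom Y Z), g • f = 0 -> exists u : phom Q Z, u • q = g].

Record biprod X Y := Biprod {
  bs : A;
  bi1 : phom X bs; bi2 : phom Y bs; bp1 : phom bs X; bp2 : phom bs Y;
  bp1i1 : bp1 • bi1 = pidm X;
  bp2i2 : bp2 • bi2 = pidm Y;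
  bp1i2 : bp1 • bi2 = 0;
  bp2i1 : bp2 • bi1 = 0;
  bipD : bi1 • bp1 + bi2 • bp2 = pidm bs
}.

Lemma biprod_direct_sum X Y (b : biprod X Y) : is_direct_sum (T := A) X Y (bs b).
Proof.
exists (bi1 b), (bi2 b) => Z f g; exists ((f : phom _ _) • bp1 b + (g : phom _ _) • bp2 b).
split=> [|u [<- <-]] /=.
  by rewrite !pcompDl -!pcompA bp1i1 bp2i2 bp1i2 bp2i1 !pcompm1 !pcompm0 addr0 add0r.
by rewrite -!pcompA -pcompDr bipD pcompm1.
Qed.

(** The projections are the morphisms induced by (1, 0) and (0, 1). The last biproduct equation is
    the uniqueness of the endomorphism of S that restricts to i1 and i2. *)
Lemma direct_sum_biprod X Y S :
  is_direct_sum (T := A) X Y S -> exists b : biprod X Y, bs b = S.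
Proof.
move=> [i1 [i2 cS]].
have [p1 [[/= p11 p12] _]] := cS X (pidm X) (0 : phom _ _).
have [p2 [[/= p21 p22] _]] := cS Y (0 : phom _ _) (pidm Y).
unshelve eexists (@Biprod X Y S i1 i2 p1 p2 p11 p22 p12 p21 _) => //.
have [u [_ u1]] := cS S i1 i2.
rewrite -(u1 (pidm S)) ?(u1 ((i1 : phom _ _) • p1 + (i2 : phom _ _) • p2)) //=.
  rewrite !pcompDl -!pcompA p11 p12 p21 p22.
  by rewrite !pcompm1 !pcompm0 addr0 add0r.
by rewrite !pcomp1m.
Qed.

Section Biproduct.
Variables (X Y : A) (b : biprod X Y).

Definition bpair W (f : phom W X) (g : phom W Y) : phom W (bs b) :=
  bi1 b • f + bi2 b • g.

Lemma bp1_pair W (f : phom W X) (g : phom W Y) : bp1 b • bpair f g = f.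
Proof. by rewrite pcompDr !pcompA bp1i1 bp1i2 pcomp1m pcomp0m addr0. Qed.

Lemma bp2_pair W (f : phom W X) (g : phom W Y) : bp2 b • bpair f g = g.
Proof. by rewrite pcompDr !pcompA bp2i1 bp2i2 pcomp1m pcomp0m add0r. Qed.

Lemma bpair_eta W (h : phom W (bs b)) : bpair (bp1 b • h) (bp2 b • h) = h.
Proof. by rewrite /bpair !pcompA -pcompDl bipD pcomp1m. Qed.

Lemma biprod_ext W (f g : phom W (bs b)) :
  bp1 b • f = bp1 b • g -> bp2 b • f = bp2 b • g -> f = g.
Proof. by move=> e1 e2; rewrite -(bpair_eta f) -(bpair_eta g) e1 e2. Qed.

Lemma bpair_comp V W (f : phom W X) (g : phom W Y) (h : phom V W) :
  bpair f g • h = bpair (f • h) (g • h).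
Proof. by rewrite /bpair pcompDl -!pcompA. Qed.

End Biproduct.

End Preadditive.

Arguments bpair {A X Y} b {W} f g.

Section Abelian.
Variables (A : preadditive) (abA : abelian A).
Implicit Types W X Y Z : A.

Lemma zero_morphismE X Y (f : phom X Y) : zero_morphism (T := A) f <-> f = 0.
Proof.
split=> [|->]; first exact: zero_morphism0.
have [Z Z0] := ab_zero abA.
by exists Z, (0 : phom _ _), (0 : phom _ _); split=> //=; rewrite pcomp0m.
Qed.

Lemma is_kernelE K X Y (k : phom K X) (f : phom X Y) :
  is_kernel (T := A) k f <-> kernel_of k f.
Proof.
split=> [[/zero_morphismE fk ku]|[fk mk ku]].
  split=> //= [W g kg|W g fg].
    have /ku[u [_ u1]] : zero_morphism (T := A) (comp (c := A) f (0 : phom W X)).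
      by apply/zero_morphismE; rewrite /= pcompm0.
    by rewrite -(u1 g kg) -(u1 0 (pcompm0 _ _)).
  by have /zero_morphismE/ku[u [? _]] := fg; exists u.
split=> [|W g /zero_morphismE/ku[u ug]]; first exact/zero_morphismE.
by exists u; split=> // v vg; apply: ((monoE k).2 mk); rewrite /= ug.
Qed.

Lemma is_cokernelE X Y Q (q : phom Y Q) (f : phom X Y) :
  is_cokernel (T := A) q f <-> cokernel_of q f.
Proof.
split=> [[/zero_morphismE qf qu]|[qf eq qu]].
  split=> //= [Z g gq|Z g gf].
    have /qu[u [_ u1]] : zero_morphism (T := A) (comp (c := A) (0 : phom Y Z) f).
      by apply/zero_morphismE; rewrite /= pcomp0m.
    by rewrite -(u1 g gq) -(u1 0 (pcomp0m _ _)).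
  by have /zero_morphismE/qu[u [? _]] := gf; exists u.
split=> [|W g /zero_morphismE/qu[u ug]]; first exact/zero_morphismE.
by exists u; split=> // v vg; apply: ((epiE q).2 eq); rewrite /= ug.
Qed.

Lemma kernel_exists X Y (f : phom X Y) : exists K (k : phom K X), kernel_of k f.
Proof. by have [K [k /is_kernelE]] := ab_kernel abA f; exists K, k. Qed.

Lemma cokernel_exists X Y (f : phom X Y) : exists Q (q : phom Y Q), cokernel_of q f.
Proof. by have [Q [q /is_cokernelE]] := ab_cokernel abA f; exists Q, q. Qed.

Lemma biprod_exists X Y : inhabited (biprod X Y).
Proof. by have [S /direct_sum_biprod[b _]] := ab_sum abA X Y. Qed.

Definition bsum X Y : biprod X Y := inhabited_witness (biprod_exists X Y).

(* The pullback of the epimorphism [e] along [a], whose projection to [W] is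
   epi because [e] is the cokernel of its kernel. *)
Lemma epi_cover X Z W (e : phom X Z) (a : phom W Z) : pepi e ->
  exists V (e' : phom V W) (a' : phom V X), pepi e' /\ e • a' = a • e'.
Proof.
move=> ee; pose b := bsum X W.
pose f := e • bp1 b - a • bp2 b.
have [V [k [fk mk ku]]] := kernel_exists f.
exists V, (bp2 b • k), (bp1 b • k); split; last first.
  by apply/eqP; rewrite -subr_eq0 !pcompA -pcompBl fk.
have ef : pepi f.
  move=> T t tf; apply: ee; have := congr1 (fun h => h • bi1 b) tf.
  by rewrite pcomp0m -pcompA pcompBl -!pcompA bp1i1 bp2i1 !pcompm0 !pcompm1 subr0.
have /epiE/(ab_epi abA)[V' [g /is_cokernelE [fg _ gu]]] := ef.
move=> T t tk; have [|s sf] := gu T (t • bp2 b).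
  by have [u <-] := ku _ g fg; rewrite pcompA -[_ • k]pcompA tk pcomp0m.
have s0 : s = 0.
  apply: ee; have := congr1 (fun h => h • bi1 b) sf.
  by rewrite -!pcompA pcompBl -!pcompA bp1i1 bp2i1 !pcompm0 subr0 pcompm1.
have := congr1 (fun h => h • bi2 b) sf.
by rewrite s0 !pcomp0m -pcompA bp2i2 pcompm1.
Qed.

Lemma pepi_comp X Y Z (g : phom Y Z) (f : phom X Y) : pepi g -> pepi f -> pepi (g • f).
Proof. by move=> eg ef T t; rewrite pcompA => /ef/eg. Qed.

Lemma pmono_comp X Y Z (g : phom Y Z) (f : phom X Y) : pmono g -> pmono f -> pmono (g • f).
Proof. by move=> eg ef T t; rewrite -pcompA => /eg/ef. Qed.

Lemma pepi_id X : pepi (pidm X).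
Proof. by move=> Z g; rewrite pcompm1. Qed.

(** As a mono, f is the kernel of some g; as f is epi, g = 0, so the identity of Y factors through
    f. *)
Lemma mono_epi_iso X Y (f : phom X Y) : pmono f -> pepi f -> is_iso (T := A) f.
Proof.
move=> mf ef; have /monoE/(ab_mono abA)[Z [g /is_kernelE[/ef g0 _ fu]]] := mf.
have [|u fu1] := fu _ (pidm Y); first by rewrite g0 pcomp0m.
exists u; split=> //=; apply/eqP; rewrite -subr_eq0; apply/eqP/mf.
by rewrite pcompBr pcompA fu1 pcomp1m pcompm1 subrr.
Qed.

(** The factorization f' of f through the kernel k of q is epi: if t f' = 0 and l is the kernel of
    t, then the mono k l is the kernel of some g; this g kills f, hence factors through q and kills
    k, so l is a split epi and t = 0. The claim follows by pulling f' back along x. *)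
Lemma cokernel_exact X Y Q (q : phom Y Q) (f : phom X Y) W (x : phom W Y) :
  cokernel_of q f -> q • x = 0 ->
  exists V (e : phom V W) (c : phom V X), pepi e /\ f • c = x • e.
Proof.
move=> [qf _ qu] qx; have [K [k [qk mk ku]]] := kernel_exists q.
have [f' ff'] := ku _ f qf; have [x' xx'] := ku _ x qx.
suff ef' : pepi f'.
  have [V [e [c [ee ec]]]] := epi_cover x' ef'.
  by exists V, e, c; split=> //; rewrite -ff' -xx' -!pcompA ec.
move=> T t tf'; have [L [l [tl ml lu]]] := kernel_exists t.
have [f'' lf''] := lu _ f' tf'.
have /monoE/(ab_mono abA)[Y' [g /is_kernelE[gkl _ glu]]] := pmono_comp mk ml.
have [|g' gg'] := qu _ g.
  by rewrite -ff' -lf'' [k • _]pcompA pcompA gkl pcomp0m.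
have [|w kw] := glu _ k; first by rewrite -gg' -pcompA qk pcompm0.
rewrite -[t]pcompm1; suff <- : l • w = pidm K by rewrite pcompA tl pcomp0m.
apply/eqP; rewrite -subr_eq0; apply/eqP/mk.
by rewrite pcompBr pcompA kw pcompm1 subrr.
Qed.

End Abelian.

(** * Quasi-isomorphisms *)

Section QuasiIso.
Variables (A : preadditive) (abA : abelian A).
Implicit Types (W : A) (C D : bcomplex A).

Lemma is_cohomologyE C (j : int) (Z H : A) (z : phom Z (C j)) (p : phom Z H) :
  is_cohomology z p <-> kernel_of z (cd C j (j + 1)) /\
    exists b : phom (C (j - 1)) Z, z • b = cd C (j - 1) j /\ cokernel_of p b.
Proof.
split=> [zp|[kz [b [zb pb]]] i k ij jk].
  have [/(is_kernelE abA) kz [b [zb /(is_cokernelE abA) pb]]] :=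
    zp (j - 1) (j + 1) (subrK _ _) erefl.
  by split=> //; exists b.
have {ij} -> : i = j - 1 by lia.
subst k; split; first exact/is_kernelE.
by exists b; split=> //; exact/is_cokernelE.
Qed.

Lemma cohomology_exists C (j : int) :
  exists (Z H : A) (z : phom Z (C j)) (p : phom Z H), is_cohomology z p.
Proof.
have [Z [z kz]] := kernel_exists abA (cd C j (j + 1)).
have [_ _ /(_ _ _ (cd_comp C (j - 1) j (j + 1)))[b zb]] := kz.
have [H [p pb]] := cokernel_exists abA b.
by exists Z, H, z, p; apply/is_cohomologyE; split=> //; exists b.
Qed.

(* Elementwise form of [quasi_iso]: morphisms from an object [W] serve as
   elements, and may be restricted along epimorphisms onto [W]. *)
Definition locally_quasi_iso C D (f : chain_map C D) :=
  (forall (j : int) W (x : phom W (C j)) (y : phom W (D (j - 1))),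
    cd C j (j + 1) • x = 0 -> f j • x = cd D (j - 1) j • y ->
    exists V (e : phom V W) (c : phom V (C (j - 1))),
      pepi e /\ x • e = cd C (j - 1) j • c) /\
  (forall (j : int) W (y : phom W (D j)), cd D j (j + 1) • y = 0 ->
    exists V (e : phom V W) (x : phom V (C j)) (c : phom V (D (j - 1))),
      [/\ pepi e, cd C j (j + 1) • x = 0 & y • e = f j • x + cd D (j - 1) j • c]).

(** A class in cohomology lifts to a cycle after an epimorphism onto its domain ([epi_cover]), and a
    cycle of class zero becomes a boundary after another one ([cokernel_exact]). The local form
    frees later arguments from the choice of cohomology objects. *)
Lemma locally_quasi_isoP C D (f : chain_map C D) : locally_quasi_iso f <-> quasi_iso f.
Proof.
split=> [[fmono fepi] j Z H Z' H' z p z' p' u h|qf].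
  move=> /is_cohomologyE[[dz mz zu] [b [zb pb]]].
  move=> /is_cohomologyE[[dz' mz' zu'] [b' [zb' pb']]] /= zuf hp.
  apply: (mono_epi_iso abA) => [W a ha|T t th].
    have [pb0 ep _] := pb.
    have [W1 [e1 [z1 [ee1 pz1]]]] := epi_cover abA a ep.
    have p'uz : p' • (u • z1) = 0 by rewrite pcompA -hp -pcompA pz1 pcompA ha pcomp0m.
    have [W2 [e2 [c [ee2 uz1]]]] := cokernel_exact abA pb' p'uz.
    have [||W3 [e3 [c' [ee3 zc']]]] := fmono j W2 (z • (z1 • e2)) c.
    - by rewrite pcompA dz pcomp0m.
    - by rewrite -zb' -[RHS]pcompA uz1 !pcompA zuf.
    have ze : z1 • e2 • e3 = b • c'.
      apply/eqP; rewrite -subr_eq0; apply/eqP/mz.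
      by rewrite pcompBr pcompA zc' pcompA zb subrr.
    apply: (pepi_comp ee1 (pepi_comp ee2 ee3)).
    by rewrite !pcompA -pz1 -!pcompA [z1 • _]pcompA ze pcompA pb0 pcomp0m.
  have [pb0 ep _] := pb'; apply: ep.
  have [V [e [x [c [ee dx ze]]]]] := fepi j Z' z' dz'.
  have [x' xx'] := zu _ x dx.
  have e_eq : e = u • x' + b' • c.
    apply/eqP; rewrite -subr_eq0; apply/eqP/mz'.
    by rewrite pcompBr pcompDr ze -xx' !pcompA zuf zb' subrr.
  apply: ee; rewrite e_eq pcompDr !pcompA -[t • p' • u]pcompA -hp [t • _]pcompA th.
  by rewrite -[t • p' • b']pcompA pb0 !(pcomp0m, pcompm0) addr0.
(* One choice of cohomology on both sides, with the induced map h and its inverse h', serves both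
   halves. *)
have cohs j : exists (Z H Z' H' : A) (z : phom Z (C j)) (p : phom Z H)
    (z' : phom Z' (D j)) (p' : phom Z' H') (u : phom Z Z') (h : phom H H')
    (b : phom (C (j - 1)) Z) (b' : phom (D (j - 1)) Z') (h' : phom H' H),
    [/\ kernel_of z (cd C j (j + 1)), z • b = cd C (j - 1) j, cokernel_of p b &
    [/\ kernel_of z' (cd D j (j + 1)), z' • b' = cd D (j - 1) j, cokernel_of p' b' &
    [/\ z' • u = f j • z, h • p = p' • u, h' • h = pidm H & h • h' = pidm H']]].
  have [Z [H [z [p zp]]]] := cohomology_exists C j.
  have [Z' [H' [z' [p' zp']]]] := cohomology_exists D j.
  have [kz [b [zb pb]]] := (is_cohomologyE z p).1 zp.
  have [kz' [b' [zb' pb']]] := (is_cohomologyE z' p').1 zp'.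
  have [_ mz' zu'] := kz'; have [p'b' _ _] := pb'.
  have [|u zuf] := zu' _ (f j • z).
    by have [dz _ _] := kz; rewrite pcompA cm_comm -pcompA dz pcompm0.
  have [_ _ /(_ _ (p' • u))[|h hp]] := pb.
    suff -> : p' • u • b = p' • b' • f (j - 1) by rewrite p'b' pcomp0m.
    rewrite -!pcompA; congr (_ • _).
    apply/eqP; rewrite -subr_eq0; apply/eqP/mz'; rewrite pcompBr !pcompA zuf zb'.
    by rewrite cm_comm -pcompA zb subrr.
  have [h' [h'h hh']] := qf _ _ _ _ _ _ _ _ _ _ _ zp zp' zuf hp.
  by exists Z, H, Z', H', z, p, z', p', u, h, b, b', h'.
split=> j W.
  move=> x y dx fx.
  have [Z [H [Z' [H' [z [p [z' [p' [u [h [b [b' [h' []]]]]]]]]]]]]] := cohs j.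
  move=> [_ mz zu] zb pb [[_ mz' _] zb' [p'b' _ _] [zuf hp h'h _]].
  have [x' xx'] := zu _ x dx.
  have ux : u • x' = b' • y.
    apply/eqP; rewrite -subr_eq0; apply/eqP/mz'.
    by rewrite pcompBr !pcompA zuf zb' -pcompA xx' fx subrr.
  have px : p • x' = 0.
    rewrite -[p]pcomp1m -h'h -!pcompA [h • _]pcompA hp -pcompA ux.
    by rewrite [p' • _]pcompA p'b' pcomp0m pcompm0.
  have [V [e [c [ee bc]]]] := cokernel_exact abA pb px.
  by exists V, e, c; split=> //; rewrite -xx' -zb -!pcompA bc.
move=> y dy.
have [Z [H [Z' [H' [z [p [z' [p' [u [h [b [b' [h' []]]]]]]]]]]]]] := cohs j.
move=> [dz mz zu] zb [pb ep _] [[_ mz' zu'] zb' pb' [zuf hp _ hh']].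
have [y' yy'] := zu' _ y dy.
have [V [e [x [ee px]]]] := epi_cover abA (h' • p' • y') ep.
have p'0 : p' • (y' • e - u • x) = 0.
  rewrite pcompBr ![p' • (_ • _)]pcompA -hp -[h • p • x]pcompA px !pcompA hh' pcomp1m.
  by rewrite subrr.
have [V' [e' [c [ee' b'c]]]] := cokernel_exact abA pb' p'0.
exists V', (e • e'), (z • x • e'), c; split.
- exact: pepi_comp.
- by rewrite !pcompA dz !pcomp0m.
rewrite -zb' -[z' • b' • c]pcompA b'c pcompBl pcompBr -yy' !pcompA zuf.
by rewrite addrCA subrr addr0.
Qed.

End QuasiIso.

(** * The universal property and coproducts of the derived category *)

Section Localization.
Variable A : preadditive.
Implicit Types C D E : bcomplex A.

Local Notation DA := (derived_cat A).
Local Notation dmor f := (dmap f : hom (c := DA) _ _).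

Lemma dmap_id C : dmap (cm_id C) = idm (C : DA).
Proof. by []. Qed.

Lemma dmap_comp C D E (g : chain_map D E) (f : chain_map C D) :
  dmap (cm_comp g f) = (dmor g) ∘ (dmor f).
Proof. by rewrite /= dcomp_class; apply/dclassP/dte_map_comp. Qed.

Lemma dmap_homotopic C D (f g : chain_map C D) : homotopic f g -> dmap f = dmap g.
Proof. by move=> fg; apply/dclassP/dte_homotopic. Qed.

Lemma dmap_quasi_iso C D (s : chain_map C D) :
  quasi_iso s -> is_iso (T := DA) (dmor s).
Proof.
move=> qs; exists (dclass (dt_inv qs)); split.
  by rewrite /= dcomp_class; apply/dclassP/dte_mapK.
by rewrite /= dcomp_class; apply/dclassP/dte_invK.
Qed.

(** A formal inverse enters only through its two equations, so that P can be verified by computing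
    in the derived category, without looking at terms. *)
Lemma dhom_ind (P : forall C D : DA, C ~> D -> Prop) :
  (forall C D (f : chain_map C D), P C D (dmap f)) ->
  (forall C D (s : chain_map C D) (t : hom (c := DA) D C), quasi_iso s ->
     t ∘ (dmor s) = idm _ ->
     (dmor s) ∘ t = idm _ -> P D C t) ->
  (forall (C D E : DA) (g : D ~> E) (f : C ~> D), P D E g -> P C D f -> P C E (g ∘ f)) ->
  forall (C D : DA) (u : C ~> D), P C D u.
Proof.
move=> Pmap Pinv Pcomp C D u; rewrite -(dreprK u); move: (drepr u) => {u}.
elim=> {C D} [C D f|C D s qs|C D E b Pb a Pa]; first exact: Pmap.
  by apply: (Pinv _ _ s) => //=; rewrite dcomp_class;
    apply/dclassP; [exact: dte_mapK | exact: dte_invK].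
by rewrite -dcomp_class; exact: Pcomp.
Qed.

(* Functors on bounded complexes to which the universal property of the derived
   category applies. *)
Record loc_functor (T : category) := LocFunctor {
  lob : bcomplex A -> T;
  lmor : forall C D, chain_map C D -> lob C ~> lob D;
  lmor_id : forall C, lmor (cm_id C) = idm (lob C);
  lmor_comp : forall C D E (g : chain_map D E) (f : chain_map C D),
    lmor (cm_comp g f) = lmor g ∘ lmor f;
  lmor_homotopic : forall C D (f g : chain_map C D),
    homotopic f g -> lmor f = lmor g;
  lmor_iso : forall C D (s : chain_map C D), quasi_iso s -> is_iso (lmor s)
}.

Section Extension.
Variables (T : category) (F : loc_functor T).

Fixpoint lterm C D (a : dterm C D) : lob F C ~> lob F D :=
  match a in dterm C D return lob F C ~> lob F D with
  | dt_map C D f => lmor F f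
  | dt_inv C D s qs => sval (cid (lmor_iso F qs))
  | dt_comp C D E b c => lterm b ∘ lterm c
  end.

Lemma lterm_eq C D (a b : dterm C D) : dterm_eq a b -> lterm a = lterm b.
Proof.
elim=> //= {C D a b}.
- by move=> C D a b c _ -> _ ->.
- by move=> C D E a a' b b' _ -> _ ->.
- by move=> *; exact: compA.
- by move=> *; rewrite lmor_id comp1m.
- by move=> *; rewrite lmor_id compm1.
- by move=> *; rewrite lmor_comp.
- by move=> *; exact: lmor_homotopic.
- by move=> C D s qs; case: cid => t /= [-> _]; rewrite lmor_id.
- by move=> C D s qs; case: cid => t /= [_ ->]; rewrite lmor_id.
Qed.

Definition lext (C D : DA) (u : C ~> D) : lob F C ~> lob F D := lterm (drepr u).

Lemma lext_class C D (a : dterm C D) : lext (dclass a : hom (c := DA) _ _) = lterm a.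
Proof. exact/lterm_eq/drepr_class. Qed.

Lemma lext_map C D (f : chain_map C D) : lext (dmor f) = lmor F f.
Proof. exact: lext_class. Qed.

Lemma lext_id (C : DA) : lext (idm C) = idm (lob F C).
Proof. by rewrite -dmap_id lext_map lmor_id. Qed.

Lemma lext_comp (C D E : DA) (g : D ~> E) (f : C ~> D) : lext (g ∘ f) = lext g ∘ lext f.
Proof. exact: (lext_class (dt_comp (drepr g) (drepr f))). Qed.

End Extension.

(** The naturality square of a quasi-isomorphism yields that of its inverse, and squares compose.
    Checking chain maps thus suffices, which replaces a calculus of fractions. *)
Lemma lext_nat (T : category) (F G : loc_functor T) (eta : forall C, lob F C ~> lob G C) :
  (forall C D (f : chain_map C D), eta D ∘ lmor F f = lmor G f ∘ eta C) ->
  forall (C D : DA) (u : C ~> D), eta D ∘ lext F u = lext G u ∘ eta C.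
Proof.
move=> eta_nat; apply: dhom_ind => [C D f|C D s t qs ts st|C D E g f Pg Pf].
- by rewrite !lext_map.
- rewrite -[eta C]comp1m -[idm _](lext_id G) -ts lext_comp lext_map.
  rewrite -!compA [lmor G s ∘ _]compA -eta_nat -[lmor F s]lext_map -!compA.
  by rewrite -lext_comp st lext_id compm1.
- by rewrite !lext_comp compA Pg -compA Pf compA.
Qed.

Definition loc_id : loc_functor DA.
Proof.
exists (fun C => C : DA) (fun C D f => dmap f) => //.
- exact: dmap_comp.
- exact: dmap_homotopic.
- exact: dmap_quasi_iso.
Defined.

(** With the identity and the constant functors as sources, [lext_nat] makes the inclusions into a
    sum natural in each of the two variables. *)
Lemma lext_loc_id (C D : DA) (u : C ~> D) : lext loc_id u = u.
Proof.
move: C D u; apply: dhom_ind => [C D f|C D s t qs ts st|C D E g f Pg Pf].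
- exact: lext_map.
- rewrite -[LHS](compm1 (c := DA)) -st compA -[RHS]comp1m.
  by rewrite -[X in _ = X ∘ _](lext_id loc_id) -ts lext_comp lext_map.
- by rewrite lext_comp Pg Pf.
Qed.

Definition loc_const (T : category) (Z : T) : loc_functor T.
Proof.
exists (fun=> Z) (fun _ _ _ => idm Z) => //.
  by move=> *; rewrite comp1m.
by move=> *; exists (idm Z); rewrite comp1m.
Defined.

Lemma lext_loc_const (T : category) (Z : T) (C D : DA) (u : C ~> D) :
  lext (loc_const Z) u = idm Z.
Proof.
move: C D u; apply: dhom_ind => [C D f|C D s t qs ts st|C D E g f Pg Pf].
- exact: lext_map.
- have := lext_comp (loc_const Z) t (dmor s).
  by rewrite ts lext_id lext_map /= compm1.
- by rewrite lext_comp Pg Pf comp1m.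
Qed.

End Localization.

(** * Direct sums in the derived category *)

Section SumComplex.
Variables (A : preadditive) (abA : abelian A).
Implicit Types C D E : bcomplex A.

Local Notation DA := (derived_cat A).
Local Notation dmor f := (dmap f : hom (c := DA) _ _).
Local Notation "X ⊞ Y" := (bsum abA X Y) (at level 50).

Definition csum C D : bcomplex A.
Proof.
exists (fun i => bs (C i ⊞ D i))
  (fun i j => bpair (C j ⊞ D j) (cd C i j • bp1 (C i ⊞ D i)) (cd D i j • bp2 (C i ⊞ D i))).
- by move=> i j ij; rewrite /bpair !cd_shape // !pcomp0m !pcompm0 addr0.
- move=> i j k; rewrite bpair_comp -!pcompA bp1_pair bp2_pair !pcompA !cd_comp.
  by rewrite /bpair !pcomp0m !pcompm0 addr0.
- have [M CM] := cbounded C; have [N DN] := cbounded D.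
  exists (M + N)%N => i iMN; apply/zero_objectE; apply: biprod_ext.
    by rewrite pcompm0; apply/to_zero/CM; lia.
  by rewrite pcompm0; apply/to_zero/DN; lia.
Defined.

Definition csum_map C D C' D' (f : chain_map C C') (g : chain_map D D') :
  chain_map (csum C D) (csum C' D').
Proof.
exists (fun i => bpair (C' i ⊞ D' i) (f i • bp1 (C i ⊞ D i)) (g i • bp2 (C i ⊞ D i))).
move=> i j /=; apply: biprod_ext.
  by rewrite !pcompA !bp1_pair -!pcompA !bp1_pair !pcompA cm_comm.
by rewrite !pcompA !bp2_pair -!pcompA !bp2_pair !pcompA cm_comm.
Defined.

Definition cin1 C D : chain_map C (csum C D).
Proof.
exists (fun i => bi1 (C i ⊞ D i)) => i j /=; apply: biprod_ext.
  by rewrite !pcompA bp1_pair bp1i1 -pcompA bp1i1 pcomp1m pcompm1.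
by rewrite !pcompA bp2_pair bp2i1 -pcompA bp2i1 pcomp0m pcompm0.
Defined.

Definition cin2 C D : chain_map D (csum C D).
Proof.
exists (fun i => bi2 (C i ⊞ D i)) => i j /=; apply: biprod_ext.
  by rewrite !pcompA bp1_pair bp1i2 -pcompA bp1i2 pcomp0m pcompm0.
by rewrite !pcompA bp2_pair bp2i2 -pcompA bp2i2 pcomp1m pcompm1.
Defined.

Definition cfold C : chain_map (csum C C) C.
Proof.
exists (fun i => bp1 (C i ⊞ C i) + bp2 (C i ⊞ C i)) => i j /=.
by rewrite pcompDl bp1_pair bp2_pair pcompDr.
Defined.

Lemma csum_map_id C D : csum_map (cm_id C) (cm_id D) = cm_id (csum C D).
Proof. by apply: chain_map_ext => i /=; rewrite !pcomp1m /bpair bipD. Qed.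

Lemma csum_map_comp C D C' D' C'' D'' (f' : chain_map C' C'') (g' : chain_map D' D'')
    (f : chain_map C C') (g : chain_map D D') :
  csum_map (cm_comp f' f) (cm_comp g' g) = cm_comp (csum_map f' g') (csum_map f g).
Proof.
apply: chain_map_ext => i /=.
by rewrite bpair_comp -!pcompA bp1_pair bp2_pair.
Qed.

Lemma homotopic_refl C D (f : chain_map C D) : homotopic f f.
Proof.
by exists (fun i j => 0) => i j k _ _; rewrite pcomp0m pcompm0 addr0 subrr.
Qed.

Lemma csum_map_homotopic C D C' D' (f f' : chain_map C C') (g g' : chain_map D D') :
  homotopic f f' -> homotopic g g' -> homotopic (csum_map f g) (csum_map f' g').
Proof.
move=> [s fs] [t gt].
exists (fun i j => bpair (C' j ⊞ D' j) (s i j • bp1 (C i ⊞ D i)) (t i j • bp2 (C i ⊞ D i))).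
move=> i j k ij jk /=; apply: biprod_ext.
  rewrite pcompBr pcompDr !pcompA !bp1_pair -!pcompA !bp1_pair !pcompA.
  by rewrite -pcompBl -pcompDl (fs i j k).
rewrite pcompBr pcompDr !pcompA !bp2_pair -!pcompA !bp2_pair !pcompA.
by rewrite -pcompBl -pcompDl (gt i j k).
Qed.

(** The second component is solved over the domain of the epimorphism that solves the first; the two
    epimorphisms are then composed. *)
Lemma csum_map_quasi_iso C D C' D' (f : chain_map C C') (g : chain_map D D') :
  quasi_iso f -> quasi_iso g -> quasi_iso (csum_map f g).
Proof.
move=> /(locally_quasi_isoP abA)[fm fe] /(locally_quasi_isoP abA)[gm ge].
apply/(locally_quasi_isoP abA); split=> j W.
  move=> x y /= dx fx.
  have [||V1 [e1 [c1 [ee1 xc1]]]] := fm j W (bp1 _ • x) (bp1 _ • y).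
  - by have := congr1 (pcomp (bp1 _)) dx; rewrite !pcompA bp1_pair pcompm0.
  - by have := congr1 (pcomp (bp1 _)) fx; rewrite !pcompA !bp1_pair.
  have [||V2 [e2 [c2 [ee2 xc2]]]] := gm j V1 (bp2 _ • x • e1) (bp2 _ • y • e1).
  - have := congr1 (fun h => bp2 _ • h • e1) dx.
    by rewrite !pcompA bp2_pair pcompm0 pcomp0m.
  - by have := congr1 (fun h => bp2 _ • h • e1) fx; rewrite !pcompA !bp2_pair.
  exists V2, (e1 • e2), (bpair _ (c1 • e2) c2); split; first exact: pepi_comp.
  apply: biprod_ext.
    by rewrite !pcompA bp1_pair -!pcompA bp1_pair !pcompA xc1.
  by rewrite !pcompA bp2_pair -!pcompA bp2_pair !pcompA xc2.
move=> y /= dy.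
have [|V1 [e1 [x1 [c1 [ee1 dx1 yc1]]]]] := fe j W (bp1 _ • y).
  by have := congr1 (pcomp (bp1 _)) dy; rewrite !pcompA bp1_pair pcompm0.
have [|V2 [e2 [x2 [c2 [ee2 dx2 yc2]]]]] := ge j V1 (bp2 _ • y • e1).
  have := congr1 (fun h => bp2 _ • h • e1) dy.
  by rewrite !pcompA bp2_pair pcompm0 pcomp0m.
exists V2, (e1 • e2), (bpair _ (x1 • e2) x2), (bpair _ (c1 • e2) c2).
split; first exact: pepi_comp.
  rewrite bpair_comp -!pcompA bp1_pair bp2_pair !pcompA dx1 dx2 pcomp0m.
  by rewrite /bpair !pcompm0 addr0.
apply: biprod_ext.
  rewrite pcompDr !pcompA !bp1_pair -!pcompA !bp1_pair !pcompA yc1.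
  by rewrite pcompDl.
by rewrite pcompDr !pcompA !bp2_pair -!pcompA !bp2_pair !pcompA yc2.
Qed.

Lemma quasi_iso_id C : quasi_iso (cm_id C).
Proof.
apply/(locally_quasi_isoP abA); split=> j W.
  move=> x y dx; rewrite /= pcomp1m => ->.
  by exists W, (pidm W), y; rewrite pcompm1; split=> //; exact: pepi_id.
move=> y dy; exists W, (pidm W), y, 0; rewrite pcompm1 pcomp1m pcompm0 addr0.
by split=> //; exact: pepi_id.
Qed.

(** The universal property extends functors of one variable, so the sum is extended in each variable
    separately. *)
Definition loc_sumr E : loc_functor A DA.
Proof.
exists (fun C => csum C E : DA) (fun C D f => dmap (csum_map f (cm_id E))).
- by move=> C; rewrite csum_map_id.
- by move=> C D F g f; rewrite -dmap_comp -csum_map_comp;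
    congr (dmap (csum_map _ _)); apply: chain_map_ext => i /=; rewrite pcomp1m.
- move=> C D f g fg; apply/dmap_homotopic/csum_map_homotopic => //.
  exact: homotopic_refl.
- move=> C D s qs; apply/dmap_quasi_iso/csum_map_quasi_iso => //.
  exact: quasi_iso_id.
Defined.

Definition loc_suml E : loc_functor A DA.
Proof.
exists (fun C => csum E C : DA) (fun C D f => dmap (csum_map (cm_id E) f)).
- by move=> C; rewrite csum_map_id.
- by move=> C D F g f; rewrite -dmap_comp -csum_map_comp;
    congr (dmap (csum_map _ _)); apply: chain_map_ext => i /=; rewrite pcomp1m.
- move=> C D f g fg; apply/dmap_homotopic/csum_map_homotopic => //.
  exact: homotopic_refl.
- move=> C D s qs; apply/dmap_quasi_iso/csum_map_quasi_iso => //.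
  exact: quasi_iso_id.
Defined.

(** Naturality in D and then in C reduces b and a to chain maps, for which both sides are the sum of
    the two maps. This makes [dsum] a bifunctor. *)
Lemma sum_interchange (C C' D D' : DA) (a : C ~> C') (b : D ~> D') :
  lext (loc_suml C') b ∘ lext (loc_sumr D) a = lext (loc_sumr D') a ∘ lext (loc_suml C) b.
Proof.
symmetry; apply: (@lext_nat A DA (loc_suml C) (loc_suml C')
  (fun D => lext (loc_sumr D) a)) => {b} {}D {}D' g; symmetry.
apply: (@lext_nat A DA (loc_sumr D) (loc_sumr D')
  (fun C => lmor (loc_suml C) g)) => {a} {}C {}C' f.
rewrite /= -[LHS]dmap_comp -[RHS]dmap_comp -!csum_map_comp; congr (dmap (csum_map _ _)).
  by apply: chain_map_ext => i /=; rewrite pcomp1m pcompm1.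
by apply: chain_map_ext => i /=; rewrite pcomp1m pcompm1.
Qed.

Definition dsum (C C' D D' : DA) (a : C ~> C') (b : D ~> D') :
  (csum C D : DA) ~> (csum C' D' : DA) := lext (loc_suml C') b ∘ lext (loc_sumr D) a.

Lemma dsum_comp (C C' C'' D D' D'' : DA) (a' : C' ~> C'') (b' : D' ~> D'')
    (a : C ~> C') (b : D ~> D') : dsum (a' ∘ a) (b' ∘ b) = dsum a' b' ∘ dsum a b.
Proof.
rewrite /dsum !lext_comp -!compA; congr (_ ∘ _).
by rewrite !compA sum_interchange.
Qed.

Lemma dsum_map C C' D D' (f : chain_map C C') (g : chain_map D D') :
  dsum (dmor f) (dmor g) = dmap (csum_map f g).
Proof.
rewrite /dsum !lext_map /= -[LHS]dmap_comp -csum_map_comp; congr (dmap (csum_map _ _)).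
  by apply: chain_map_ext => i /=; rewrite pcomp1m.
by apply: chain_map_ext => i /=; rewrite pcompm1.
Qed.

Definition dfold C : (csum C C : DA) ~> (C : DA) := dmap (cfold C).

(** This gives uniqueness in the universal property of the sum. Both variables of [dsum] move
    together, so the proof is by induction on u. *)
Lemma dfold_nat (C D : DA) (u : C ~> D) : u ∘ dfold C = dfold D ∘ dsum u u.
Proof.
move: C D u; apply: dhom_ind => [C D f|C D s t qs ts st|C D E g f Pg Pf].
- rewrite dsum_map -[LHS]dmap_comp -[RHS]dmap_comp; congr dmap.
  by apply: chain_map_ext => i /=; rewrite pcompDl bp1_pair bp2_pair pcompDr.
- have sE : dmor s ∘ dfold C = dfold D ∘ dsum (dmor s) (dmor s).
    rewrite dsum_map -[LHS]dmap_comp -[RHS]dmap_comp; congr dmap.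
    by apply: chain_map_ext => i /=; rewrite pcompDl bp1_pair bp2_pair pcompDr.
  rewrite -[dfold C](comp1m (c := DA)) -ts -[t ∘ _ ∘ dfold C]compA sE.
  rewrite -compA -[_ ∘ _ ∘ dsum t t]compA -dsum_comp st.
  by rewrite -!dmap_id dsum_map csum_map_id dmap_id compm1.
- by rewrite -compA Pf compA Pg -compA dsum_comp.
Qed.

Lemma dsum_in1 (C D Z Z' : DA) (a : C ~> Z) (b : D ~> Z') :
  dsum a b ∘ dmor (cin1 C D) = (dmor (cin1 Z Z')) ∘ a.
Proof.
rewrite /dsum -compA.
have -> : lext (loc_sumr D) a ∘ dmor (cin1 C D) =
    (dmor (cin1 Z D)) ∘ a.
  have := @lext_nat A DA (loc_id A) (loc_sumr D) (fun C => dmap (cin1 C D)).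
  move=> /(_ _ C Z a); rewrite lext_loc_id => -> // {a b} {}C {}Z f.
  rewrite /= -[LHS]dmap_comp -[RHS]dmap_comp; congr dmap; apply: chain_map_ext => i /=.
  by rewrite /bpair pcompDl -!pcompA bp1i1 bp2i1 !pcompm0 addr0 pcompm1.
rewrite compA; congr (_ ∘ _).
have := @lext_nat A DA (loc_const A (Z : DA)) (loc_suml Z) (fun D => dmap (cin1 Z D)).
move=> /(_ _ D Z' b); rewrite lext_loc_const compm1 => <- // {a b} {}D {}Z' f.
rewrite compm1 /= -[RHS]dmap_comp; congr dmap; apply: chain_map_ext => i /=.
by rewrite /bpair pcompDl -!pcompA bp1i1 bp2i1 !pcompm0 addr0 pcomp1m pcompm1.
Qed.

Lemma dsum_in2 (C D Z Z' : DA) (a : C ~> Z) (b : D ~> Z') :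
  dsum a b ∘ dmor (cin2 C D) = (dmor (cin2 Z Z')) ∘ b.
Proof.
rewrite /dsum sum_interchange -compA.
have -> : lext (loc_suml C) b ∘ dmor (cin2 C D) =
    (dmor (cin2 C Z')) ∘ b.
  have := @lext_nat A DA (loc_id A) (loc_suml C) (fun D => dmap (cin2 C D)).
  move=> /(_ _ D Z' b); rewrite lext_loc_id => -> // {a b} {}D {}Z' f.
  rewrite /= -[LHS]dmap_comp -[RHS]dmap_comp; congr dmap; apply: chain_map_ext => i /=.
  by rewrite /bpair pcompDl -!pcompA bp1i2 bp2i2 !pcompm0 add0r pcompm1.
rewrite compA; congr (_ ∘ _).
have := @lext_nat A DA (loc_const A (Z' : DA)) (loc_sumr Z') (fun C => dmap (cin2 C Z')).
move=> /(_ _ C Z a); rewrite lext_loc_const compm1 => <- // {a b} {}C {}Z f.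
rewrite compm1 /= -[RHS]dmap_comp; congr dmap; apply: chain_map_ext => i /=.
by rewrite /bpair pcompDl -!pcompA bp1i2 bp2i2 !pcompm0 add0r pcomp1m pcompm1.
Qed.

(** No addition is defined on morphisms of the derived category, so the biproduct equations cannot
    be used there. The fold map replaces them: u is recovered as u composed with the fold of the two
    inclusions, and the fold is natural. *)
Lemma csum_direct_sum C D : is_direct_sum (T := DA) C D (csum C D).
Proof.
exists (dmap (cin1 C D)), (dmap (cin2 C D)) => Z f g.
exists (dfold Z ∘ dsum f g); split.
  have e1 : cm_comp (cfold Z) (cin1 Z Z) = cm_id Z.
    by apply: chain_map_ext => i /=; rewrite pcompDl bp1i1 bp2i1 addr0.
  have e2 : cm_comp (cfold Z) (cin2 Z Z) = cm_id Z.
    by apply: chain_map_ext => i /=; rewrite pcompDl bp1i2 bp2i2 add0r.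
  split; rewrite -compA; first by rewrite dsum_in1 compA -[dfold Z ∘ _]dmap_comp e1 comp1m.
  by rewrite dsum_in2 compA -[dfold Z ∘ _]dmap_comp e2 comp1m.
move=> u [<- <-]; rewrite dsum_comp compA -dfold_nat -compA dsum_map -[X in u ∘ X]dmap_comp.
rewrite [cm_comp _ _](_ : _ = cm_id _) ?dmap_id ?compm1 //.
apply: chain_map_ext => i /=; rewrite pcompDl bp1_pair bp2_pair.
exact: bipD.
Qed.

End SumComplex.

(** * Complexes with zero differential and their cones *)

Lemma dep_choice (I : Type) (T : I -> Type) (P : forall i, T i -> Prop) :
  (forall i, exists x, P i x) -> exists f : forall i, T i, forall i, P i (f i).
Proof. by move=> H; exists (fun i => sval (cid (H i))) => i; case: cid. Qed.

Section ZeroDifferential.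
Variables (A : preadditive) (abA : abelian A).
Implicit Types C D E : bcomplex A.

Local Notation DA := (derived_cat A).
Local Notation dmor f := (dmap f : hom (c := DA) _ _).
Local Notation "X ⊞ Y" := (bsum abA X Y) (at level 50).

Lemma isomorphicE (Y Z : A) : isomorphic (T := A) Y Z <->
  exists (f : phom Y Z) (g : phom Z Y), g • f = pidm Y /\ f • g = pidm Z.
Proof.
split=> [[f [g [gf fg]]]|[f [g [gf fg]]]]; first by exists f, g.
by exists f, g.
Qed.

Lemma isomorphic_refl (Y : A) : isomorphic (T := A) Y Y.
Proof. by apply/isomorphicE; exists (pidm Y), (pidm Y); rewrite pcomp1m. Qed.

Lemma zero_object_isomorphic (Y Z : A) :
  zero_object (T := A) Y -> zero_object (T := A) Z -> isomorphic (T := A) Y Z.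
Proof.
move=> /zero_objectE Y0 /zero_objectE Z0; apply/isomorphicE.
by exists 0, 0; rewrite Y0 Z0 !pcomp0m.
Qed.

Lemma dmap_iso C D (f : chain_map C D) (g : chain_map D C) :
  cm_comp g f = cm_id C -> cm_comp f g = cm_id D -> is_iso (T := DA) (dmor f).
Proof. by move=> gf fg; exists (dmap g); rewrite -!dmap_comp gf fg. Qed.

Lemma zero_diff_isomorphic C D :
  (forall i j, cd C i j = 0) -> (forall i j, cd D i j = 0) ->
  (forall i, isomorphic (T := A) (C i) (D i)) -> isomorphic (T := DA) C D.
Proof.
move=> dC dD isoCD.
have /dep_choice[f /dep_choice[g fg]] i := (isomorphicE (C i) (D i)).1 (isoCD i).
unshelve eexists (dmap (@ChainMap _ C D f _)).
  by move=> i j; rewrite dC dD pcomp0m pcompm0.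
apply: (@dmap_iso _ _ _ (@ChainMap _ D C g _)).
- by move=> i j; rewrite dC dD pcomp0m pcompm0.
- by move=> ?; apply: chain_map_ext => i; have [] := fg i.
- by move=> ?; apply: chain_map_ext => i; have [] := fg i.
Qed.

Definition bounded_family (Q : int -> A) :=
  exists N : nat, forall i : int, (N < `|i|)%N -> zero_object (T := A) (Q i).

Definition zero_diff (Q : int -> A) (bQ : bounded_family Q) : bcomplex A.
Proof.
exists Q (fun _ _ => 0) => // i j k; exact: pcomp0m.
Defined.

Lemma biprod_zero_l (Y Z : A) (b : biprod Y Z) :
  zero_object (T := A) Y -> isomorphic (T := A) Z (bs b).
Proof.
move=> Y0; apply/isomorphicE; exists (bi2 b), (bp2 b); split; first exact: bp2i2.
by rewrite -(bipD b) [bp1 b]to_zero // pcompm0 add0r.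
Qed.

Lemma biprod_zero_r (Y Z : A) (b : biprod Y Z) :
  zero_object (T := A) Z -> isomorphic (T := A) Y (bs b).
Proof.
move=> Z0; apply/isomorphicE; exists (bi1 b), (bp1 b); split; first exact: bp1i1.
by rewrite -(bipD b) [bp2 b]to_zero // pcompm0 addr0.
Qed.

(** * Complexes with zero differential in the closure of X under shifts, sums and summands *)

Section Angle.
Variables (X : A -> Prop) (addX : additive_subcategory X).

Local Notation angleX := (angle (T := Db A) (in_degree0 X)).

Lemma angle_isomorphic C D : isomorphic (T := DA) C D -> angleX C -> angleX D.
Proof. exact: add_iso. Qed.

Lemma angle_stalk (j : int) (Q : int -> A) (bQ : bounded_family Q) :
  X (Q j) -> (forall i, i <> j -> zero_object (T := A) (Q i)) -> angleX (zero_diff bQ).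
Proof.
move=> XQ Q0.
have bQj : bounded_family (fun i => Q (i + j)).
  by exists `|j|%N => i ij; apply: Q0; lia.
apply: (@angle_isomorphic (cshift (- j) (zero_diff bQj))).
  apply: zero_diff_isomorphic => [i k|//|i] /=; first exact: sgn0.
  by rewrite (_ : i - j + j = i) ?subrK //; exact: isomorphic_refl.
apply: add_incl; exists (zero_diff bQj), (- j); split=> //; split=> /= [|i i0].
  by rewrite add0r.
by apply: Q0; lia.
Qed.

(** Such a complex is a finite sum of stalks. The induction runs over a list of degrees outside
    which Q vanishes, at the start -N, ..., N, and splits off one degree at a time. *)
Lemma angle_zero_diff (Q : int -> A) (bQ : bounded_family Q) :
  (forall i, X (Q i)) -> angleX (zero_diff bQ).
Proof.
have [N QN] := bQ.
have : forall i, i \notin [seq (n%:Z - N%:Z : int) | n <- iota 0 (2 * N + 1)] ->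
    zero_object (T := A) (Q i).
  move=> i iN; apply: QN; apply: contraR iN => iN; apply/mapP.
  by exists `|(i + N%:Z)%R|%N; [rewrite mem_iota; lia | lia].
move: [seq _ | _ <- _] => s {N QN}; elim: s => [|j s IHs] in Q bQ * => Q0 XQ.
  by apply: (@angle_stalk 0) => // i _; exact: Q0.
have [O O0] := ab_zero abA.
pose Q1 i := if i == j then Q i else O; pose Q2 i := if i == j then O else Q i.
have bQ1 : bounded_family Q1.
  by have [N QN] := bQ; exists N => i iN; rewrite /Q1; case: eqP => // _; exact: QN.
have bQ2 : bounded_family Q2.
  by have [N QN] := bQ; exists N => i iN; rewrite /Q2; case: eqP => // _; exact: QN.
have XO : X O by exact: (as_zero addX).
apply: (@angle_isomorphic (csum abA (zero_diff bQ1) (zero_diff bQ2))).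
  apply: zero_diff_isomorphic => [i k|//|i] /=.
    by rewrite /bpair !pcomp0m !pcompm0 addr0.
  suff /isomorphicE[f [g [gf fg]]] : isomorphic (T := A) (Q i) (bs (Q1 i ⊞ Q2 i)).
    by apply/isomorphicE; exists g, f.
  rewrite /Q1 /Q2; case: (i == j); first exact: biprod_zero_r.
  exact: biprod_zero_l.
apply: add_sum (csum_direct_sum abA _ _) _ _.
  apply: (@angle_stalk j) => [|i /eqP/negPf ij]; first by rewrite /Q1 eqxx.
  by rewrite /Q1 ij.
apply: IHs => i; rewrite /Q2; case: eqP => // /eqP ij // iNs.
by apply: Q0; rewrite in_cons negb_or ij.
Qed.

Definition retract_of (Q : A) := exists (x : A) (s : phom Q x) (r : phom x Q),
  X x /\ r • s = pidm Q.

(** The complement is the kernel of the retraction. When Q is zero, x is taken to be zero instead,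
    so that in a bounded family of retracts the chosen x, and with them the complements, are again
    bounded. *)
Lemma retract_complement (Q : A) : retract_of Q -> exists (x Q' : A),
  [/\ X x, isomorphic (T := A) (bs (Q ⊞ Q')) x
    & zero_object (T := A) Q -> zero_object (T := A) x].
Proof.
move=> Qx; have [O O0] := ab_zero abA.
have [Q0|nQ0] := pselect (zero_object (T := A) Q).
  exists O, O; split=> //; first exact: (as_zero addX).
  apply: zero_object_isomorphic => //; apply/zero_objectE/biprod_ext;
    exact: etrans (to_zero _ _) (esym (to_zero _ _)).
have [x [s [r [Xx rs]]]] := Qx.
have [Q' [k [rk mk ku]]] := kernel_exists abA r.
have [|p kp] := ku _ (pidm x - s • r).
  by rewrite pcompBr pcompA rs pcomp1m pcompm1 subrr.
exists x, Q'; split=> //; apply/isomorphicE.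
exists (s • bp1 _ + k • bp2 _), (bpair _ r p); split; last first.
  by rewrite pcompDl -!pcompA bp1_pair bp2_pair kp addrCA subrr addr0.
have ps : p • s = 0.
  by apply: mk; rewrite pcompA kp pcompBl -pcompA rs pcompm1 pcomp1m subrr.
have pk : p • k = pidm Q'.
  apply/eqP; rewrite -subr_eq0; apply/eqP/mk; rewrite pcompBr pcompA kp.
  by rewrite pcompBl -pcompA rk pcompm0 subr0 pcompm1 pcomp1m subrr.
apply: biprod_ext; rewrite pcompm1 pcompA ?bp1_pair ?bp2_pair pcompDr !pcompA.
  by rewrite rs rk pcomp1m pcomp0m addr0.
by rewrite ps pk pcomp1m pcomp0m add0r.
Qed.

Lemma angle_retract (Q : int -> A) (bQ : bounded_family Q) :
  (forall i, retract_of (Q i)) -> angleX (zero_diff bQ).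
Proof.
move=> retQ; have /dep_choice[U /dep_choice[Q' UQ']] i := retract_complement (retQ i).
have bU : bounded_family U.
  by have [N QN] := bQ; exists N => i /QN; have [_ _] := UQ' i.
have bQ' : bounded_family Q'.
  have [N UN] := bU; exists N => i /UN U0; apply/zero_objectE.
  have [_ /isomorphicE[f [g [gf _]]] _] := UQ' i.
  rewrite -(bp2i2 (Q i ⊞ Q' i)) -[bi2 _]pcomp1m -gf [f]to_zero //.
  by rewrite pcompm0 pcomp0m pcompm0.
apply: add_summand (csum_direct_sum abA (zero_diff bQ) (zero_diff bQ')) _.
apply: (@angle_isomorphic (zero_diff bU)); last first.
  by apply: angle_zero_diff => i; have [] := UQ' i.
apply: zero_diff_isomorphic => [//|i k|i] /=.
  by rewrite /bpair !pcomp0m !pcompm0 addr0.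
have [_ /isomorphicE[f [g [gf fg]]] _] := UQ' i.
by apply/isomorphicE; exists g, f.
Qed.

End Angle.

(** * The cone of a chain map from a complex with zero differential *)

Section Cone.
Variables (M : bcomplex A) (Q : int -> A) (bQ : bounded_family Q).
Variable q : forall i, phom (Q i) (M i).
Hypothesis dq : forall i, cd M i (i + 1) • q i = 0.

(** [cd] is defined for every pair of degrees, so a component Q^(i+1) -> M^j is required for all i
    and j; it is made to factor through [q j]. *)
Definition family_cast (i j : int) : phom (Q i) (Q j) :=
  if i =P j is ReflectT e then ecast k (phom (Q i) (Q k)) e (pidm (Q i)) else 0.

Lemma family_castE i : family_cast i i = pidm (Q i).
Proof. by rewrite /family_cast; case: eqP => // e; rewrite eq_axiomK. Qed.

Lemma family_cast0 i j : i <> j -> family_cast i j = 0.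
Proof. by rewrite /family_cast; case: eqP. Qed.

Lemma cd_q i j : cd M i j • q i = 0.
Proof.
have [->|/eqP ij] := eqVneq j (i + 1); first exact: dq.
by rewrite cd_shape // pcomp0m.
Qed.

Definition from_zero_diff : chain_map (zero_diff bQ) M.
Proof. by exists q => i j /=; rewrite pcompm0 cd_q. Defined.

(* The mapping cone of [from_zero_diff]; the cast is the identity from
   Q^(i+1) to Q^j when j = i + 1 and zero otherwise. *)
Definition zcone : bcomplex A.
Proof.
exists (fun i => bs (Q (i + 1) ⊞ M i)) (fun i j => bi2 (Q (j + 1) ⊞ M j) •
  (q j • family_cast (i + 1) j • bp1 (Q (i + 1) ⊞ M i) + cd M i j • bp2 (Q (i + 1) ⊞ M i))).
- move=> i j ij; rewrite cd_shape // family_cast0; last by move=> e; exact: ij.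
  by rewrite pcompm0 !pcomp0m addr0 pcompm0.
- move=> i j k; rewrite -[LHS]pcompA pcompDl -[_ • bp1 _ • _]pcompA [bp1 _ • _]pcompA bp1i2.
  rewrite -[_ • bp2 _ • _]pcompA [bp2 _ • _]pcompA bp2i2 pcomp0m pcomp1m.
  rewrite [cd M j k • _]pcompDr !pcompA cd_q cd_comp.
  by rewrite !(pcomp0m, pcompm0) !addr0 pcompm0.
- have [N MN] := cbounded M; have [N' QN'] := bQ.
  exists (N + N' + 1)%N => i iN.
  apply/zero_objectE/biprod_ext; rewrite pcompm0; apply: to_zero.
    by apply: QN'; lia.
  by apply: MN; lia.
Defined.

Lemma zcone_cone :
  exists (i : chain_map M zcone) (p : chain_map zcone (cshift 1 (zero_diff bQ))),
    is_cone from_zero_diff i p.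
Proof.
unshelve eexists (@ChainMap _ M zcone (fun n => bi2 _) _).
  move=> i j /=; rewrite -pcompA; congr (_ • _).
  by rewrite pcompDl -!pcompA bp1i2 bp2i2 !pcompm0 add0r pcompm1.
unshelve eexists (@ChainMap _ zcone (cshift 1 (zero_diff bQ)) (fun n => bp1 _) _).
  by move=> i j /=; rewrite pcompA bp1i2 pcomp0m sgn0 pcomp0m.
exists (fun n => bi1 _), (fun n => bp2 _); split=> n /=.
- exact: bp1i1.
- exact: bp2i2.
- by split; [exact: bp1i2 | exact: bp2i1].
- exact: bipD.
- rewrite pcompA bp2i2 pcomp1m family_castE pcompm1 pcompDl -!pcompA bp1i1 bp2i1.
  by rewrite !pcompm0 addr0 pcompm1.
Qed.

Lemma star_zcone (S1 S2 : Db A -> Prop) :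
  S1 (zero_diff bQ) -> S2 zcone -> star S1 S2 M.
Proof.
move=> S1Q S2K; have [i [p ip]] := zcone_cone.
exists (zero_diff bQ), zcone, (dmap from_zero_diff), (dmap i), (dmap p); split=> //.
exists (zero_diff bQ), M, zcone, from_zero_diff, i, p; split=> //.
exists (idm _), (idm _), (idm _); split.
  by split; apply: (dmap_iso (g := cm_id _)); apply: chain_map_ext => n /=; exact: pcomp1m.
rewrite !comp1m !compm1; split=> //.
have -> : dshift 1 (dmap (cm_id (zero_diff bQ))) = dmap (cm_id (cshift 1 (zero_diff bQ))).
  by rewrite [LHS]dshift_class; congr (dmap _); apply: chain_map_ext.
exact: (comp1m (c := DA)).
Qed.

End Cone.

End ZeroDifferential.

(** * Resolutions of the cohomology relative to X *)

Section RelativeResolutions.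
Variables (A : preadditive) (abA : abelian A).
Variables (X : A -> Prop) (addX : additive_subcategory X).
Implicit Types (W : A) (M : bcomplex A).

Local Notation angleX := (angle (T := Db A) (in_degree0 X)).

(* A resolution of length [n] of the subfunctor [B] of Hom(-,Q), restricted to
   [X], by functors Hom(-,Q_i) with [Q_i] a retract of an object of [X]. *)
Fixpoint resolved_by (n : nat) (Q : A) (B : forall W, phom W Q -> Prop) : Prop :=
  match n with
  | 0 => forall W y, X W -> B W y -> y = 0
  | n'.+1 => exists (Q1 : A) (d : phom Q1 Q), [/\ retract_of X Q1,
      forall W y, X W -> (B W y <-> exists z, y = d • z)
    & resolved_by n' (fun W (z : phom W Q1) => d • z = 0)]
  end.

Lemma resolved_by_ext n (Q : A) (B B' : forall W, phom W Q -> Prop) :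
  (forall W y, X W -> B W y <-> B' W y) -> resolved_by n B -> resolved_by n B'.
Proof.
case: n => [|n] BB' /=; first by move=> H W y XW By; apply: H => //; exact/BB'.
move=> [Q1 [d [rQ1 Bd rn]]]; exists Q1, d; split=> // W y XW.
by rewrite -BB' // Bd.
Qed.

Lemma retract_of_zero (Z : A) : zero_object (T := A) Z -> retract_of X Z.
Proof.
move=> Z0; exists Z, (pidm Z), (pidm Z); rewrite pcomp1m.
by split=> //; exact: (as_zero addX).
Qed.

Lemma resolved_by_zero n (Q : A) (B : forall W, phom W Q -> Prop) :
  zero_object (T := A) Q -> (forall W, X W -> B W 0) -> resolved_by n B.
Proof.
elim: n Q B => [|n IHn] Q B Q0 B0 /=; first by move=> W y _ _; exact: to_zero.
have [O O0] := ab_zero abA; exists O, 0; split; first exact: retract_of_zero.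
  move=> W y XW; rewrite [y]to_zero //; split=> _; last exact: B0.
  by exists 0; rewrite pcomp0m.
by apply: IHn => // W XW; rewrite pcompm0.
Qed.

(* Such a resolution of the [j]-th cohomology of Hom(-,M), restricted to [X]. *)
Definition cohomology_resolution n M (j : int) (Q : A) (q : phom Q (M j)) : Prop :=
  [/\ retract_of X Q, cd M j (j + 1) • q = 0
    & forall i : int, i + 1 = j ->
      (forall W (x : phom W (M j)), X W -> cd M j (j + 1) • x = 0 ->
        exists y (m : phom W (M i)), x = q • y + cd M i j • m) /\
      resolved_by n (fun W (y : phom W Q) =>
        exists m : phom W (M i), q • y = cd M i j • m)].

Definition cohomology_pd_le n M (j : int) : Prop :=
  exists (Q : A) (q : phom Q (M j)), cohomology_resolution n q.

(** Where M^j is zero the cover is chosen to be zero, resolved by zeros; otherwise the family Q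
    might be unbounded and give no object of the bounded derived category. *)
Lemma cohomology_resolutions n M : (forall j, cohomology_pd_le n M j) ->
  exists (Q : int -> A) (q : forall j, phom (Q j) (M j)),
    bounded_family Q /\ forall j, cohomology_resolution n (q j).
Proof.
move=> Mn; suff /dep_choice[Q /dep_choice[q Qq]] j : exists Q (q : phom Q (M j)),
    (zero_object (T := A) (M j) -> zero_object (T := A) Q) /\ cohomology_resolution n q.
  exists Q, q; split=> [|j]; last by have [] := Qq j.
  by have [N MN] := cbounded M; exists N => j /MN; have [] := Qq j.
have [M0|nM0] := pselect (zero_object (T := A) (M j)); last first.
  by have [Q [q qn]] := Mn j; exists Q, q.
have [O O0] := ab_zero abA; exists O, 0; split=> //; split=> [||i ij].
- exact: retract_of_zero.
- exact: pcompm0.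
split=> [W x _ _|].
  by exists 0, 0; rewrite !pcompm0 addr0; exact: to_zero.
by apply: resolved_by_zero => // W _; exists 0; rewrite !pcompm0.
Qed.

(** * Passing to the cone shortens the resolutions *)

Section Step.
Variables (n : nat) (M : bcomplex A) (Q : int -> A) (bQ : bounded_family Q).
Variable q : forall j, phom (Q j) (M j).
Hypothesis dq : forall j, cd M j (j + 1) • q j = 0.

Local Notation K := (zcone abA bQ dq).

Lemma zcone_dE i W (y : phom W (Q (i + 1))) (m : phom W (M i)) :
  cd K i (i + 1) • bpair _ y m = bi2 _ • (q (i + 1) • y + cd M i (i + 1) • m).
Proof.
rewrite /= -pcompA; congr (_ • _); rewrite family_castE pcompm1 pcompDl.
by rewrite -!pcompA bp1_pair bp2_pair.
Qed.

(** A cycle of hK in degree j is a pair (y, m) with q y + d m = 0, so y ranges over the kernel of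
    hQ^(j+1) -> H^(j+1)(hM); surjectivity of hQ^j -> H^j(hM) shows that y determines the class. The
    next term Q1 of the resolution in degree j+1 therefore covers H^j(hK). *)
Lemma zcone_pd_le j : (forall j, cohomology_resolution n.+1 (q j)) ->
  cohomology_pd_le n K j.
Proof.
move=> qn; have [_ _ /(_ j erefl)[_ /= [Q1 [d [rQ1 Bd rn]]]]] := qn (j + 1).
(* Q1 need not lie in X, where [Bd] can be applied. So d is first composed with the retraction x ->
   Q1, and the resulting morphism is restricted along the section. *)
have [m qdm] : exists m, q (j + 1) • d = cd M j (j + 1) • m.
  have [x [s [r [Xx rs]]]] := rQ1.
  have [|m qdr] := (Bd x (d • r) Xx).2; first by exists r.
  by exists (m • s); rewrite pcompA -qdr -!pcompA rs pcompm1.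
exists Q1, (bpair _ d (- m)); split=> //.
  by rewrite zcone_dE qdm pcompNr subrr pcompm0.
move=> i ij; subst j; set q1 := bpair _ _ _.
have [_ _ /(_ i erefl)[surj _]] := qn (i + 1).
split.
  move=> W x XW; rewrite -(bpair_eta x) zcone_dE.
  set a := bp1 _ • x; set b := bp2 _ • x => /(congr1 (pcomp (bp2 _))).
  rewrite pcompA bp2i2 pcomp1m pcompm0 => ab0.
  have [|z az] := (Bd W a XW).1.
    by exists (- b); apply/eqP; rewrite pcompNr -addr_eq0 ab0.
  (* The difference x - q1 z has components 0 and b + m z. The latter is a cycle of M, hence q y
     plus a boundary, and this is the differential of (y, m') in K. *)
  have [|y [m' e]] := surj W (b + m • z) XW.
    by rewrite pcompDr pcompA -qdm -pcompA -az; apply: etrans ab0; exact: addrC.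
  exists z, (bpair _ y m'); rewrite zcone_dE -e /q1 bpair_comp -az /bpair.
  by rewrite -[RHS]addrA -pcompDr pcompNl [- _ + _]addrC addrK.
apply: resolved_by_ext rn => W z XW; split=> [dz|[k q1z]].
  have [|y [m' e]] := surj W (- (m • z)) XW.
    by rewrite pcompNr pcompA -qdm -pcompA dz pcompm0 oppr0.
  exists (bpair _ y m'); rewrite zcone_dE -e /q1 bpair_comp dz /bpair.
  by rewrite pcompm0 add0r pcompNl.
have := congr1 (pcomp (bp1 _)) q1z.
by rewrite -(bpair_eta k) zcone_dE !pcompA bp1_pair bp1i2 pcomp0m.
Qed.

End Step.

Hypothesis genX : generating X.

(** The hypotheses speak only of morphisms from objects of X; generation provides, over each W, an
    epimorphism from such an object, which is what the local form of a quasi-isomorphism permits. *)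
Lemma angle_projective_cohomology M : (forall j, cohomology_pd_le 0 M j) -> angleX M.
Proof.
move=> /cohomology_resolutions[Q [q [bQ qn]]].
have dq j : cd M j (j + 1) • q j = 0 by have [] := qn j.
apply: (angle_isomorphic (C := zero_diff bQ)); last first.
  by apply: (angle_retract abA addX) => j; have [] := qn j.
exists (dmap (from_zero_diff bQ dq)); apply/dmap_quasi_iso.
have cover W : exists V (e : phom V W), X V /\ pepi e.
  by have [V [e [XV /epiE ee]]] := genX W; exists V, e.
apply/(locally_quasi_isoP abA); split=> j W.
  move=> x y _ qx; have [V [e [XV ee]]] := cover W.
  have [_ _ /(_ (j - 1) (subrK _ _))[_ r0]] := qn j.
  exists V, e, 0; split=> //; rewrite pcompm0; apply: r0 => //.
  by exists (y • e); rewrite !pcompA -qx.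
move=> y dy; have [V [e [XV ee]]] := cover W.
have [_ _ /(_ (j - 1) (subrK _ _))[surj _]] := qn j.
have [|x [m yE]] := surj V (y • e) XV; first by rewrite pcompA dy pcomp0m.
by exists V, e, x, m; split=> //; exact: pcomp0m.
Qed.

Lemma angle_pow_pd_le n M : (forall j, cohomology_pd_le n M j) ->
  iter n (star (T := Db A) angleX) angleX M.
Proof.
elim: n M => [|n IHn] M Mn; first exact: angle_projective_cohomology.
have [Q [q [bQ qn]]] := cohomology_resolutions Mn.
have dq j : cd M j (j + 1) • q j = 0 by have [] := qn j.
rewrite iterS; apply: (star_zcone (bQ := bQ) (dq := dq) (abA := abA)).
  by apply: (angle_retract abA addX) => j; have [] := qn j.
by apply: IHn => j; exact: zcone_pd_le.
Qed.

End RelativeResolutions.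

(** * Finitely presented modules *)

Section SubgroupQuotient.
Variables (V : zmodType) (P : V -> Prop).
Hypotheses (P0 : P 0) (PB : forall v w, P v -> P w -> P (v - w)).

Let inP : {pred V} := fun v => `[< P v >].

Fact inP_zmod_closed : zmod_closed inP.
Proof.
split; first exact/asboolP.
by move=> v w /asboolP Pv /asboolP Pw; exact/asboolP/PB.
Qed.

HB.instance Definition _ := GRing.isZmodClosed.Build V inP inP_zmod_closed.

Lemma subgroup_quotient : exists (Q : zmodType) (p : V -> Q),
  [/\ zmod_morphism p, forall u, exists v, p v = u & forall v, p v = 0 <-> P v].
Proof.
exists (Quotient.quot (inP : zmodClosed V)), (fun v => \pi_(Quotient.quot inP)%qT v); split.
- by move=> v w; rewrite raddfB.
- by move=> u; exists (repr u); rewrite reprK.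
move=> v; rewrite -(raddf0 (\pi_(Quotient.quot inP)%qT)).
split=> [e|Pv]; last by apply/eqP; rewrite -Quotient.idealrBE subr0; exact/asboolP.
by apply/asboolP; have /eqP := e; rewrite -Quotient.idealrBE subr0.
Qed.

End SubgroupQuotient.

(** * Epimorphisms, exactness and projectives among finitely presented modules *)

Section ModuleCategory.
Variable C : preadditive.
Hypothesis sumC : forall x y : C, exists b : biprod x y, True.
Hypothesis zeroC : exists z : C, zero_object (T := C) z.
Implicit Types F G : cmodule C.

Lemma mactB F (x y : C) (f g : phom x y) (m : F y) :
  mact (f - g) m = mact f m - mact g m.
Proof. exact: (mact_addl m f g). Qed.

Lemma mact0 F (x y : C) (m : F y) : mact (0 : phom x y) m = 0.
Proof. by rewrite -(subrr (0 : phom x y)) mactB subrr. Qed.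

Lemma mactDl F (x y : C) (f g : phom x y) (m : F y) :
  mact (f + g) m = mact f m + mact g m.
Proof. by apply: (addIr (- mact g m)); rewrite -mactB !addrK. Qed.

Lemma mactm0 F (x y : C) (f : phom x y) : mact f (0 : F y) = 0.
Proof. by rewrite -(subrr (0 : F y)) mact_add subrr. Qed.

Lemma nt0 F G (a : nat_trans F G) x : a x 0 = 0.
Proof. by rewrite -(subrr 0) nt_add subrr. Qed.

Definition nt_zero F G : nat_trans F G.
Proof.
by exists (fun x m => 0) => [x m m'|x y f m]; [rewrite subrr | rewrite mactm0].
Defined.

Definition nt_of_elem F (x : C) (m : F x) : nat_trans (yoneda x) F.
Proof.
exists (fun w f => mact f m) => [w f g|w y g f]; first exact: mactB.
exact: mact_comp.
Defined.

Lemma quotient_module G (N : forall x, G x -> Prop) :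
  (forall x, N x 0) -> (forall x m m', N x m -> N x m' -> N x (m - m')) ->
  (forall x y (f : phom x y) m, N y m -> N x (mact f m)) ->
  exists (F : cmodule C) (p : nat_trans G F),
    (forall x u, exists m, p x m = u) /\ (forall x m, p x m = 0 <-> N x m).
Proof.
move=> N0 NB Nact.
have /dep_choice[Q /dep_choice[p pP]] x := subgroup_quotient (N0 x) (NB x).
have padd x : zmod_morphism (p x) by have [] := pP x.
have pker x m : p x m = 0 <-> N x m by have [_ _] := pP x.
have /dep_choice[s sK] (xu : {x & Q x}) : exists m, p (tag xu) m = tagged xu.
  by have [_ /(_ (tagged xu))] := pP (tag xu).
(* The action is computed on a chosen preimage; [actE] shows that the choice does not matter. *)
pose act x y (f : phom x y) (u : Q y) : Q x := p x (mact f (s (Tagged Q u))).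
have actE x y f m : act x y f (p y m) = p x (mact f m).
  apply/eqP; rewrite -subr_eq0 /act -padd -mact_add; apply/eqP/pker/Nact/pker.
  by rewrite padd (sK (Tagged Q (p y m))) subrr.
have psurj x u : exists m, p x m = u by exists (s (Tagged Q u)); exact: (sK (Tagged Q u)).
have act_add x y (f : phom x y) : zmod_morphism (act x y f).
  move=> u v; have [m <-] := psurj y u; have [n <-] := psurj y v.
  by rewrite -padd !actE mact_add padd.
have act_addl x y u : zmod_morphism (fun f : phom x y => act x y f u).
  by move=> f g; have [m <-] := psurj y u; rewrite !actE mactB padd.
have act_id x u : act x x (pidm x) u = u.
  by have [m <-] := psurj x u; rewrite actE mact_id.
have act_comp x y z (g : phom y z) (f : phom x y) u :
    act x z (g • f) u = act x y f (act y z g u).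
  by have [m <-] := psurj z u; rewrite !actE mact_comp.
pose F := CModule act_add act_addl act_id act_comp.
have p_nat x y (f : phom x y) (m : G y) : p x (mact f m) = @mact C F x y f (p y m).
  exact/esym/actE.
by exists F, (@NatTrans C G F p padd p_nat).
Qed.

(** By Yoneda, a presentation amounts to a morphism a and a generator m of F, the images of the
    identities. *)
Lemma finitely_presentedP F : finitely_presented F <->
  exists (x1 x0 : C) (a : phom x1 x0) (m : F x0),
    (forall w n, exists f : phom w x0, mact f m = n) /\
    (forall w (f : phom w x0), mact f m = 0 <-> exists g : phom w x1, a • g = f).
Proof.
split=> [[x1 [x0 [a [b [bs ab]]]]]|[x1 [x0 [a [m [ms am]]]]]].
  have bE w f : b w f = mact f (b x0 (pidm x0)) by rewrite -nt_nat /= pcomp1m.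
  have aE w (g : phom w x1) : a w g = (a x1 (pidm x1) : phom x1 x0) • g.
    by have := nt_nat a g (pidm x1); rewrite /= pcomp1m.
  exists x1, x0, (a x1 (pidm x1)), (b x0 (pidm x0)); split=> [w n|w f].
    by have [f fn] := bs w n; exists f; rewrite -bE.
  by rewrite -bE ab; split=> -[g <-]; exists g; [exact/esym/aE | exact: aE].
exists x1, x0, (@nt_of_elem (yoneda x0) x1 a), (nt_of_elem m).
by split; [exact: ms | exact: am].
Qed.

Definition fp_yoneda (x : C) : fp_mod C.
Proof.
exists (yoneda x); apply/finitely_presentedP.
exists x, x, 0, (pidm x); split=> [w f|w f] /=; first by exists f; rewrite pcomp1m.
rewrite pcomp1m; split=> [->|[g <-]]; last by rewrite pcomp0m.
by exists 0; rewrite pcomp0m.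
Defined.

Implicit Types K M N P : fp_mod C.

Lemma fp_zero_objectE M : zero_object M <-> forall x (m : sval M x), m = 0.
Proof.
split=> [[/(_ M)[f [_ f1]] _] x m|M0].
  have id0 := etrans (esym (f1 (idm M) I)) (f1 (nt_zero _ _) I).
  exact: (congr1 (fun a : nat_trans _ _ => a x m) id0).
split=> N; exists (nt_zero _ _); split=> // f _; apply: nat_trans_ext => x m /=.
  by rewrite [RHS]M0.
by rewrite [m]M0 nt0.
Qed.

Lemma fp_zero_morphismE M N (f : M ~> N) :
  zero_morphism f <-> forall x m, (f : nat_trans _ _) x m = 0.
Proof.
split=> [[Z [g [h [/fp_zero_objectE Z0 ->]]]] x m|f0].
  by rewrite /= (Z0 x ((h : nat_trans _ _) x m)) nt0.
have [z z0] := zeroC.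
exists (fp_yoneda z), (nt_zero _ _), (nt_zero _ _); split.
  by apply/fp_zero_objectE => x m; exact: to_zero.
by apply: nat_trans_ext => x m; rewrite f0.
Qed.

Lemma fp_surj_epi M N (f : M ~> N) :
  (forall x n, exists m, (f : nat_trans _ _) x m = n) -> epi f.
Proof.
move=> fs Z g h gh; apply: nat_trans_ext => x n; have [m <-] := fs x n.
exact: (congr1 (fun a : nat_trans _ _ => a x m) gh).
Qed.

(** The objectwise cokernel of f is the test object, and the point is that it is finitely presented:
    to the relations x1 -> x0 of N one adds v : y0 -> x0, which represents the image of the
    generator of M. *)
Lemma fp_epi_surj M N (f : M ~> N) : epi f ->
  forall x n, exists m, (f : nat_trans _ _) x m = n.
Proof.
move=> ef; case: N => N fpN in f ef *; case: M => M fpM in f ef *.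
have [x1 [x0 [a [n [ns an]]]]] := (finitely_presentedP N).1 fpN.
have [_ [y0 [_ [m [ms _]]]]] := (finitely_presentedP M).1 fpM.
have [v vn] := ns y0 ((f : nat_trans M N) y0 m).
have [b _] := sumC x1 y0.
have [||x y g u [u' <-]|Q [p [ps pk]]] :=
    @quotient_module N (fun x u => exists u', (f : nat_trans M N) x u' = u).
- by move=> x; exists 0; rewrite nt0.
- by move=> x _ _ [u <-] [u' <-]; exists (u - u'); rewrite nt_add.
- by exists (mact g u'); rewrite nt_nat.
have fpQ : finitely_presented Q.
  apply/finitely_presentedP; exists (bs b), x0, (a • bp1 b + v • bp2 b), (p x0 n).
  split=> [w u|w g].
    have [n' <-] := ps w u; have [g <-] := ns w n'.
    by exists g; rewrite nt_nat.
  rewrite -nt_nat pk; split=> [[u fu]|[h <-]].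
    have [k ku] := ms w u.
    have [|h ah] := (an w (g - v • k)).1.
      by rewrite mactB mact_comp vn -fu -ku nt_nat subrr.
    by exists (bpair b h k); rewrite pcompDl -!pcompA bp1_pair bp2_pair ah subrK.
  exists (mact (bp2 b • h) m); rewrite nt_nat -vn -mact_comp pcompDl mactDl.
  suff -> : mact (a • bp1 b • h) n = 0 by rewrite add0r pcompA.
  by apply/an; exists (bp1 b • h); rewrite pcompA.
have p0 : (p : hom (c := fp_mod C) (exist _ N fpN) (exist _ Q fpQ)) = nt_zero N Q.
  apply: ef; apply: nat_trans_ext => x u /=; apply/pk; by exists u.
by move=> x u; apply/pk; rewrite p0.
Qed.

(** An element of N at x is a morphism from the representable module at x, which is finitely
    presented; the universal property of the kernel, tested on it, is a statement about elements. *)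
Lemma fp_exact_atE M N K (f : M ~> N) (g : N ~> K) : exact_at f g ->
  forall x n, (g : nat_trans _ _) x n = 0 <-> exists m, (f : nat_trans _ _) x m = n.
Proof.
move=> [L [k [u [[gk ku] -> /fp_epi_surj us]]]] x n.
move/fp_zero_morphismE: gk => gk.
split=> [gn|[m <-]]; last exact: gk.
have [|h [kh _]] := ku (fp_yoneda x) (nt_of_elem n).
  by apply/fp_zero_morphismE => w y /=; rewrite nt_nat gn mactm0.
have [m um] := us x ((h : nat_trans _ _) x (pidm x)).
exists m; rewrite /= um.
have := congr1 (fun t : nat_trans (yoneda x) (sval N) => t x (pidm x)) kh.
by rewrite /= mact_id.
Qed.

(* The endomorphism [s x p] of [x] is the idempotent whose image is [P]. *)
Lemma fp_projective_splits P : projective P ->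
  exists (x : C) (p : sval P x) (s : nat_trans (sval P) (yoneda x)),
    forall w (m : sval P w), mact (s w m : phom w x) p = m.
Proof.
move=> projP; have [_ [x [_ [p [pgen _]]]]] := (finitely_presentedP _).1 (svalP P).
have [|s ps] := projP (fp_yoneda x) P (nt_of_elem p) (idm P).
  exact: fp_surj_epi.
exists x, p, s => w m.
exact: (congr1 (fun t : nat_trans _ _ => t w m) ps).
Qed.

End ModuleCategory.

(** * From projective resolutions to relative resolutions *)

Section Resolutions.
Variables (A : preadditive) (abA : abelian A).
Variables (X : A -> Prop) (addX : additive_subcategory X).

Local Notation C := (full_sub X).

Lemma full_sub_biprod (x y : C) : exists b : biprod x y, True.
Proof.
case: x y => x Xx [y Xy]; pose b := bsum abA x y.
have Xb : X (bs b) by exact: (as_sum addX (biprod_direct_sum b)).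
by exists (@Biprod C (exist _ x Xx) (exist _ y Xy) (exist _ (bs b) Xb)
  (bi1 b) (bi2 b) (bp1 b) (bp2 b) (bp1i1 b) (bp2i2 b) (bp1i2 b) (bp2i1 b) (bipD b)).
Qed.

Lemma full_sub_zero : exists z : C, zero_object (T := C) z.
Proof.
have [O O0] := ab_zero abA.
exists (exist _ O (as_zero addX O0)); apply/zero_objectE.
exact: (zero_objectE O).1.
Qed.

(** The image of e is the kernel of 1 - e, which exists in A; for x in X it may lie outside X. *)
Lemma idempotent_splits (x : A) (e : phom x x) : e • e = e ->
  exists Q (s : phom Q x) (r : phom x Q), r • s = pidm Q /\ s • r = e.
Proof.
move=> ee; have [Q [s [es ms su]]] := kernel_exists abA (pidm x - e).
have [|r sr] := su _ e; first by rewrite pcompBl pcomp1m ee subrr.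
exists Q, s, r; split=> //; apply/eqP; rewrite -subr_eq0; apply/eqP/ms.
rewrite pcompBr pcompA sr pcompm1.
by move/eqP: es; rewrite pcompBl pcomp1m subr_eq0 => /eqP <-; rewrite subrr.
Qed.

(* An isomorphism from Hom(-,Q), restricted to [X], to [P]. *)
Record representation (P : cmodule C) := Representation {
  rep_obj : A;
  rep_dom : C;
  rep_sect : phom rep_obj (sval rep_dom);
  rep_retr : phom (sval rep_dom) rep_obj;
  rep_elem : P rep_dom;
  rep_inv : forall w : C, P w -> phom (sval w) rep_obj;
  rep_retrK : rep_retr • rep_sect = pidm rep_obj;
  rep_invK : forall (w : C) (m : P w),
    mact (rep_sect • rep_inv m : phom w rep_dom) rep_elem = m;
  rep_invI : forall (w : C) (y : phom (sval w) rep_obj),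
    rep_inv (mact (rep_sect • y : phom w rep_dom) rep_elem) = y
}.

Definition rep_fun (P : cmodule C) (R : representation P) (w : C)
  (y : phom (sval w) (rep_obj R)) : P w :=
  mact (rep_sect R • y : phom w (rep_dom R)) (rep_elem R).

Lemma rep_fun_comp (P : cmodule C) (R : representation P) (v w : C)
    (y : phom (sval w) (rep_obj R)) (f : phom v w) :
  rep_fun (w := v) (y • (f : phom (sval v) (sval w))) = mact f (rep_fun y).
Proof. by rewrite /rep_fun -mact_comp pcompA. Qed.

Lemma rep_fun_inj (P : cmodule C) (R : representation P) (w : C)
  (y z : phom (sval w) (rep_obj R)) : rep_fun y = rep_fun z -> y = z.
Proof. by move=> yz; rewrite -[y]rep_invI -[z]rep_invI; congr (rep_inv _). Qed.

Lemma rep_fun0 (P : cmodule C) (R : representation P) (w : C) :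
  rep_fun (0 : phom (sval w) (rep_obj R)) = 0.
Proof. by rewrite /rep_fun pcompm0 mact0. Qed.

Lemma projective_representation (P : fp_mod C) : projective P ->
  exists R : representation (sval P), True.
Proof.
move=> /fp_projective_splits[x [p [s sp]]].
have sE w (f : phom w x) : s w (mact f p) = (s x p : phom x x) • f.
  exact: (nt_nat s f p).
have [|Q [i [r [ri ir]]]] := @idempotent_splits (sval x) (s x p).
  (* With e = s x p one has e p = p in P, so naturality of s gives e = s(e p) = e e. *)
  by have := sE x (s x p); rewrite sp => /esym.
unshelve eexists (@Representation (sval P) Q x i r p (fun w m => r • s w m) ri _ _) => //.
  move=> w m; rewrite pcompA ir.
  by rewrite [X in mact X _](_ : _ = (s x p : phom x x) • s w m) // mact_comp !sp.
by move=> w y /=; rewrite [s w _]sE -ir !pcompA ri pcomp1m ri pcomp1m.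
Qed.

Section ExactSequence.
Variables (P : nat -> fp_mod C) (d : forall i, P i.+1 ~> P i).
Hypothesis dP : forall i, exact_at (d i.+1) (d i).
Variable R : forall i, representation (sval (P i)).

Local Notation Q i := (rep_obj (R i)).

Lemma rep_retract i : retract_of X (Q i).
Proof.
exists (sval (rep_dom (R i))), (rep_sect (R i)), (rep_retr (R i)).
by split; [exact: svalP | exact: rep_retrK].
Qed.

(** The Yoneda image of [d i]. As Q_(i+1) may lie outside X, it is computed at the object of X of
    which Q_(i+1) is a retract and restricted along the section. *)
Definition rep_d i : phom (Q i.+1) (Q i) :=
  rep_inv (R i) ((d i : nat_trans _ _) _ (rep_elem (R i.+1))) • rep_sect (R i.+1).

Lemma rep_dE i (w : C) (y : phom (sval w) (Q i.+1)) :
  rep_fun (rep_d i • y) = (d i : nat_trans _ _) w (rep_fun y).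
Proof.
rewrite -pcompA (@rep_fun_comp _ (R i) w _ _ (rep_sect (R i.+1) • y)).
by rewrite [rep_fun (rep_inv _ _)]rep_invK [RHS]nt_nat.
Qed.

(** The tail of the resolution beyond P_k resolves the image of d_k. Modules have values only on X
    while [resolved_by] ranges over all W, hence the proof of X W inside the predicate. *)
Lemma rep_resolved_by n k : (forall i, (k + n < i)%N -> zero_object (P i)) ->
  resolved_by X n (fun W (y : phom W (Q k)) => exists (XW : X W) m,
    rep_fun (w := exist _ W XW) y = (d k : nat_trans _ _) _ m).
Proof.
elim: n k => [|n IHn] k P0 /=.
  move=> W y _ [XW [m ym]]; apply: (@rep_fun_inj _ (R k) (exist _ W XW)).
  have /fp_zero_objectE Pk0 : zero_object (P k.+1) by apply: P0; rewrite addn0.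
  by rewrite ym rep_fun0 [m]Pk0 nt0.
exists (Q k.+1), (rep_d k); split; first exact: rep_retract.
  move=> W y XW; split=> [[{}XW [m ym]]|[z ->]].
    exists (rep_inv (R k.+1) m); apply: (@rep_fun_inj _ (R k) (exist _ W XW)).
    by rewrite rep_dE ym [rep_fun (rep_inv _ _)]rep_invK.
  by exists XW, (rep_fun (w := exist _ W XW) z); rewrite rep_dE.
apply: resolved_by_ext (IHn k.+1 _) => [W z XW|i ki]; last first.
  by apply: P0; rewrite addnS -addSn.
have ex := fp_exact_atE full_sub_biprod full_sub_zero (dP k) (x := exist _ W XW).
split=> [[XW' [m zm]]|dz].
  have eXW : XW' = XW by exact: Prop_irrelevance.
  subst XW'; apply: (@rep_fun_inj _ (R k) (exist _ W XW)); rewrite rep_dE rep_fun0.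
  by apply/ex; exists m; rewrite -zm.
exists XW; have [|m zm] := (ex (rep_fun (w := exist _ W XW) z)).1.
  by rewrite -rep_dE dz rep_fun0.
by exists m; rewrite zm.
Qed.

End ExactSequence.

Hypothesis cfX : contravariantly_finite X.

(* [u] presents the [j]-th cohomology of Hom(-,M), restricted to [X], as the
   cokernel of Hom(-,a). *)
Lemma cohomology_presentation (M : bcomplex A) (i j : int) : i + 1 = j ->
  exists (x1 x0 : C) (a : phom x1 x0) (u : phom (sval x0) (M j)),
  [/\ cd M j (j + 1) • u = 0,
      forall (w : C) (x : phom (sval w) (M j)), cd M j (j + 1) • x = 0 ->
        exists y, x = u • y
    & forall (w : C) (y : phom w x0),
        (exists m : phom (sval w) (M i), u • y = cd M i j • m) <->
        exists z : phom w x1, a • z = y].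
Proof.
move=> _; have [Z [z [dz mz zu]]] := kernel_exists abA (cd M j (j + 1)).
have [U0 [f [XU0 fU]]] := cfX Z.
have [u uE] : exists u, u = z • (f : phom U0 Z) by exists (z • (f : phom U0 Z)).
pose b := bsum abA U0 (M i).
(* R is the pullback of u and the differential: its morphisms from W are the pairs (y, m) with u y =
   d m. An approximation of R by X then yields the relations. *)
have [R [k [ek mk ku]]] := kernel_exists abA (u • bp1 b - cd M i j • bp2 b).
have [U1 [g [XU1 gU]]] := cfX R.
exists (exist _ U1 XU1), (exist _ U0 XU0), (bp1 b • k • g), u; split.
- by rewrite uE pcompA dz pcomp0m.
- move=> [W XW] x /zu[x' <-]; have [y <-] := fU W x' XW.
  by exists y; rewrite uE; exact: pcompA.
move=> [W XW] y; split=> /= [[m um]|[t <-]].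
  have [|t kt] := ku W (bpair b y m).
    by rewrite pcompBl -!pcompA bp1_pair bp2_pair um subrr.
  have [t' gt] := gU W t XW.
  by exists t'; rewrite -!pcompA [g • t']gt kt bp1_pair.
exists (bp2 b • k • g • t); rewrite !pcompA; congr (_ • _ • _).
by apply/eqP; rewrite -subr_eq0 -pcompBl ek.
Qed.

(** The cokernel F of Hom(-,a) is the cohomology of hM in degree j, now as a finitely presented
    module; its projective resolution is carried back to A through the representing objects. *)
Lemma gl_dim_cohomology_pd_le n (M : bcomplex A) (j : int) :
  (forall F : fp_mod C, projective_resolution F n) -> cohomology_pd_le X n M j.
Proof.
move=> resn.
have [x1 [x0 [a [u [du ucyc ubd]]]]] := cohomology_presentation M (subrK 1 j).
have [||x y f m [g <-]|F [p [ps pk]]] :=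
    @quotient_module C (yoneda x0) (fun w y => exists z, a • z = y).
- by move=> x; exists 0; rewrite pcompm0.
- by move=> x _ _ [m <-] [m' <-]; exists (m - m'); rewrite pcompBr.
- by exists (g • f); rewrite pcompA.
have fpF : finitely_presented F.
  apply/finitely_presentedP; exists x1, x0, a, (p x0 (pidm x0)); split=> [w v|w f].
    by have [f <-] := ps w v; exists f; rewrite -nt_nat /= pcomp1m.
  by rewrite -nt_nat /= pcomp1m.
have [P [d [e [projP P0 /(fp_epi_surj full_sub_biprod) es de dd]]]] := resn (exist _ F fpF).
have ex w := fp_exact_atE full_sub_biprod full_sub_zero de (x := w).
have /dep_choice[R _] i := projective_representation (projP i).
(* By Yoneda, v lifts the augmentation P_0 -> F along Hom(-,x0) -> F; composing it with u and the
   section gives the cover q. *)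
have [v ev] := ps _ ((e : nat_trans _ _) _ (rep_elem (R 0%N))).
pose q := u • (v : phom (sval _) (sval _)) • rep_sect (R 0%N).
have eE (w : C) (y : phom (sval w) (rep_obj (R 0%N))) : (e : nat_trans _ _) w (rep_fun y) =
    p w (v • (rep_sect (R 0%N) • y : phom w (rep_dom _))).
  by rewrite [LHS]nt_nat -ev; exact: (esym (nt_nat p _ v)).
exists (rep_obj (R 0%N)), q; split; first exact: rep_retract.
  by rewrite !pcompA du !pcomp0m.
move=> i ij; have ei : i = j - 1 by lia.
subst i; split=> [W x XW dx|].
  pose w : C := exist _ W XW.
  have [y xy] := ucyc w x dx.
  have [m em] := es w (p w y).
  pose y' := rep_inv (R 0%N) m.
  have /pk/ubd[m' um'] : p w ((y : phom w x0) -
      v • (rep_sect (R 0%N) • y' : phom w (rep_dom _))) = 0.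
    by rewrite nt_add -eE [rep_fun _]rep_invK em subrr.
  exists y', m'; rewrite -um' [u • (_ - _)]pcompBr xy /q -!pcompA.
  by rewrite addrCA subrr addr0.
(* q y is a boundary exactly when the augmentation kills y, that is, when y lies in the image of
   d_0. *)
apply: resolved_by_ext (rep_resolved_by dd R (k := 0) P0) => W y XW.
rewrite /q -!pcompA.
split=> [[{}XW [m ym]]|/(ubd (exist _ W XW))/pk].
  apply/(ubd (exist _ W XW))/pk.
  by rewrite -eE; apply/ex; exists m.
by rewrite -eE => /ex[m ym]; exists XW, m.
Qed.

Lemma projective_resolution_le (T : category) (M : T) m n : (m <= n)%N ->
  projective_resolution M m -> projective_resolution M n.
Proof.
move=> mn [P [d [e [projP P0 ee ex0 ex]]]]; exists P, d, e; split=> // i ni.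
by apply: P0; exact: leq_ltn_trans ni.
Qed.

(** The infimum defining the projective dimension is attained, and a shorter resolution also counts
    as one of length n, since only vanishing beyond n is required. *)
Lemma gl_dim_resolution (T : category) n (M : T) :
  gl_dim T = Some n -> projective_resolution M n.
Proof.
rewrite /gl_dim /enat_sup /enat_inf; case: pselect => // exn [].
case: ex_minnP => k /asboolP /(_ M) + _ <- {n exn}.
rewrite /proj_dim /enat_inf; case: pselect => // exm /=.
by case: ex_minnP => m /asboolP resm _ mk; exact: projective_resolution_le resm.
Qed.

End Resolutions.

Lemma enat_inf_le (P : nat -> Prop) n : P n -> enat_le (enat_inf P) (Some n).
Proof.
move=> Pn; rewrite /enat_inf; case: pselect => [exP|[]]; last by exists n; exact/asboolP.
by case: ex_minnP => m _ /(_ n) mn; apply: mn; exact/asboolP.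
Qed.

Theorem theorem1p1 (A : preadditive) (X : A -> Prop) :
  abelian A ->
  additive_subcategory X ->
  contravariantly_finite X ->
  generating X ->
  enat_le (tri_dim (T := Db A) (in_degree0 X)) (gl_dim (fp_mod (full_sub X))).
Proof.
move=> abA addX cfX genX; case gln: (gl_dim _) => [n|]; last by case: tri_dim.
apply: enat_inf_le => M; apply: add_incl.
apply: (angle_pow_pd_le abA addX genX) => j.
by apply: (gl_dim_cohomology_pd_le abA addX cfX) => F; exact: gl_dim_resolution.
Qed.
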